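(* Let $X$ be a compact subset of a real Banach space $\mathfrak{B}$ with thickness exponent $\tau(X)=\tau(X,\mathfrak{B})<1$ and box-counting dimension $d_B(X)<\infty$. Let $k>2d_B(X)$ be an integer and let $\theta$ satisfy $$0<\theta<(1-\tau(X))\,\frac{k-2d_B(X)}{k\,(1+\tau(X))}.$$ Then there is a sequence $\mathcal{V}=\{V_n\}_{n=1}^\infty$ of finite-dimensional subspaces of the dual space $\mathfrak{B}^*$ such that, for the probability measure $\mu$ on the space $\mathbb{E}_2(\mathcal{V})$ of linear maps $L:\mathfrak{B}\to\mathbb{R}^k$ defined in the context, $\mu$-almost every linear map $L:\mathfrak{B}\to\mathbb{R}^k$ satisfies: there is a constant $C_L>0$ such that $$\|x-y\|\le C_L\,|Lx-Ly|^{\theta}\qquad\text{for all }x,y\in X.$$ In particular, every such $L$ is bijective from $X$ onto $L(X)$ with a Hölder continuous inverse.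
   Context: All Banach spaces are real, and $|\cdot|$ is the Euclidean norm on $\mathbb{R}^k$. Box-counting dimension: $d_B(X)=\limsup_{\epsilon\to0}\frac{\log N(X,\epsilon)}{-\log\epsilon}$, where $N(X,\epsilon)$ is the minimum number of balls of radius $\epsilon$ with centres in $X$ required to cover $X$. Thickness exponent: for $X\subset\mathfrak{B}$, $\tau(X,\mathfrak{B})=\limsup_{\epsilon\to0}\frac{\log d(X,\epsilon)}{-\log\epsilon}$, where $d(X,\epsilon)$ is the smallest dimension of those linear subspaces $V$ of $\mathfrak{B}$ that satisfy $\mathrm{dist}_{\mathfrak{B}}(x,V)\le\epsilon$ for all $x\in X$ (and $d(X,\epsilon)=\infty$ if no such finite-dimensional subspace exists). The measure $\mu$: let $\mathcal{V}=\{V_n\}_{n=1}^\infty$ be a sequence of finite-dimensional subspaces of $\mathfrak{B}^*$, let $d_n=\dim V_n$ and let $B_n$ be the closed unit ball of $V_n$ (in the norm of $\mathfrak{B}^*$). Define $$\mathbb{E}_2(\mathcal{V})=\Big\{L=(L_1,\dots,L_k):\ L_i=\sum_{n=1}^\infty n^{-2}\phi_{i,n},\ \phi_{i,n}\in B_n\Big\},$$ each element being regarded as a linear map $\mathfrak{B}\to\mathbb{R}^k$. Choosing a basis of $V_n$ identifies $B_n$ with a symmetric convex set $U_n\subset\mathbb{R}^{d_n}$; let $\lambda_n$ be the probability measure on $B_n$ corresponding to normalised $d_n$-dimensional Lebesgue measure on $U_n$. The elements $L\in\mathbb{E}_2(\mathcal{V})$ are parametrised by the families $(\phi_{i,n})_{1\le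 i\le k,\,n\ge1}\in\big(\prod_{n=1}^\infty B_n\big)^k$, and $\mu=\mu_0^{\otimes k}$, where $\mu_0=\bigotimes_{n=1}^\infty\lambda_n$. That is, $\mu$ is the law of $L$ when all the $\phi_{i,n}$ are chosen independently with $\phi_{i,n}$ distributed according to $\lambda_n$. ''$\mu$-almost every $L$'' is understood with respect to this measure. *)

(* Defs.v *)
From HB Require Import structures.
From mathcomp Require Import all_boot all_order all_algebra.
From mathcomp Require Import all_classical all_reals all_analysis.
Import Order.TTheory GRing.Theory Num.Theory.
Import numFieldNormedType.Exports.
Set Implicit Arguments.
Unset Strict Implicit.
Unset Printing Implicit Defensive.
Local Open Scope classical_set_scope.
Local Open Scope ring_scope.

Section subspaces.
Context {R : realType} {E : lmodType R}.

Definition lin_comb n (b : 'I_n -> E) (a : 'I_n -> R) : E :=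
  \sum_(j < n) a j *: b j.

Definition is_basis n (b : 'I_n -> E) (V : set E) : Prop :=
  injective (lin_comb b) /\ V = range (lin_comb b).

Definition subspace_dim n (V : set E) : Prop :=
  exists b : 'I_n -> E, is_basis b V.

End subspaces.

Section dimensions.
Context {R : realType} {B : normedModType R}.
Implicit Types (X V : set B) (e : R).

(* Both counts below are infima of sets of natural numbers embedded in
   \bar R: they are +oo when the set is empty, minima otherwise. *)
Definition covering_number X e : \bar R :=
  ereal_inf [set n%:R%:E | n in [set n : nat | exists c : 'I_n -> B,
    (forall j, X (c j)) /\ X `<=` \bigcup_j ball (c j) e]].

Definition dist x V : R := inf [set `|x - v| | v in V].

Definition approx_dim X e : \bar R :=
  ereal_inf [set n%:R%:E | n in [set n : nat | exists V : set B,
    subspace_dim n V /\ forall x, X x -> dist x V <= e]].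

(* limsup_(e -> 0+) of (log (f e)) / (- log e), with log 0 = -oo and
   log +oo = +oo. The value is -oo when f vanishes near 0, which happens for
   the thickness of a subset of {0} and for both exponents of the empty set;
   [fine] then reads it as 0. *)
Definition log_growth (f : R -> \bar R) : \bar R :=
  limf_esup (fun e => lne (f e) / (- ln e)%:E)%E (0:R)^'+.

Definition box_dim X : \bar R := log_growth (covering_number X).

Definition thickness X : \bar R := log_growth (approx_dim X).

End dimensions.

Section dual.
Context {R : realType} (B : normedModType R).

Definition dual_space : set (B -> R^o) :=
  [set f | linear f /\ continuous f].

(* Operator norm; only meaningful on dual_space, where the set is bounded. *)
Definition dual_norm (f : B -> R^o) : R :=
  sup [set `|f x| | x in [set x : B | `|x| <= 1]].

Definition dual_subspace (V : set (B -> R^o)) : Prop :=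
  V `<=` dual_space /\ exists d, subspace_dim d V.

Definition dual_ball (V : set (B -> R^o)) : set (B -> R^o) :=
  V `&` [set f | dual_norm f <= 1].

End dual.

Section lebesgue_tuple.
Context {R : realType}.
Local Notation RT n := (n.-tuple (measurableTypeR R)).

Definition cons_pair n (p : measurableTypeR R * RT n) : RT n.+1 :=
  [the n.+1.-tuple _ of p.1 :: p.2].

Lemma measurable_cons_pair n : measurable_fun setT (@cons_pair n).
Proof. exact: measurable_cons. Qed.

Section step.
Variables (n : nat) (m : {sigma_finite_measure set (RT n) -> \bar R}).

Definition lebesgue_step : set (RT n.+1) -> \bar R :=
  pushforward (lebesgue_measure \x m)%E (@cons_pair n).

Let step0 : lebesgue_step set0 = 0%E.
Proof. by rewrite /lebesgue_step /pushforward preimage_set0 measure0. Qed.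

Let step_ge0 A : (0 <= lebesgue_step A)%E.
Proof. by rewrite /lebesgue_step /pushforward; exact: measure_ge0. Qed.

Let mpre (A : set (RT n.+1)) : measurable A ->
  measurable (@cons_pair n @^-1` A).
Proof.
by move=> mA; rewrite -[X in measurable X]setTI; exact: measurable_cons_pair.
Qed.

Let step_sigma_additive : semi_sigma_additive lebesgue_step.
Proof.
move=> F mF tF mUF; rewrite /lebesgue_step /pushforward preimage_bigcup.
apply: measure_semi_sigma_additive.
- by move=> i; exact: mpre.
- apply/trivIsetP => i j _ _ ij; rewrite -preimage_setI.
  by move/trivIsetP : tF => /(_ _ _ _ _ ij) ->//; rewrite preimage_set0.
- by rewrite -preimage_bigcup; exact: mpre.
Qed.

HB.instance Definition _ := isMeasure.Build _ _ _
  lebesgue_step step0 step_ge0 step_sigma_additive.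

Let step_sigma_finite : sigma_finite setT lebesgue_step.
Proof.
have /sigma_finiteP[F [TF ndF Foo]] := sigma_finiteT (@lebesgue_measure R).
have /sigma_finiteP[G [TG ndG Goo]] := sigma_finiteT m.
pose unc (t : RT n.+1) : measurableTypeR R * RT n :=
  (tnth t ord0, [tuple of behead t]).
have consK : cancel (@cons_pair n) unc.
  by case=> x t; congr pair; apply/val_inj.
have uncK : cancel unc (@cons_pair n).
  by move=> t; rewrite /cons_pair /unc/= [RHS]tuple_eta; exact/val_inj.
have munc : measurable_fun setT unc.
  apply/measurable_fun_pairP; split.
    exact: measurable_tnth.
  exact: measurable_behead.
exists (fun i => unc @^-1` (F i `*` G i)).
  rewrite -preimage_bigcup predeqE => t; split => // _.
  have [i _ Fi] : (\bigcup_i F i) (unc t).1 by rewrite -TF.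
  have [j _ Gj] : (\bigcup_i G i) (unc t).2 by rewrite -TG.
  exists (maxn i j) => //; split.
    by move: Fi; exact/subsetPset/ndF/leq_maxl.
  by move: Gj; exact/subsetPset/ndG/leq_maxr.
move=> i; have [mF Flt] := Foo i; have [mG Glt] := Goo i; split.
  by rewrite -[X in measurable X]setTI; apply: munc => //; exact: measurableX.
rewrite /lebesgue_step /pushforward -comp_preimage.
rewrite (_ : unc \o _ = id); last exact/funext.
rewrite preimage_id product_measure1E//.
by rewrite lte_mul_pinfty// ge0_fin_numE.
Qed.

HB.instance Definition _ := Measure_isSigmaFinite.Build _ _ _
  lebesgue_step step_sigma_finite.

End step.

(* d-dimensional Lebesgue measure on d-tuples: the d-fold product of the
   one-dimensional one, a Dirac mass when d = 0. *)
Fixpoint lebesgue_tuple n : {sigma_finite_measure set (RT n) -> \bar R} :=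
  if n is n'.+1 then lebesgue_step (lebesgue_tuple n')
  else \d_([tuple] : RT 0).

End lebesgue_tuple.

Section random_maps.
Context {R : realType} {B : normedModType R}.
Local Notation RT n := (n.-tuple (measurableTypeR R)).

Section unit_ball_law.
Variables (n : nat) (b : 'I_n -> B -> R^o).

Definition unit_ball_coord : set (RT n) :=
  [set a | dual_norm (lin_comb b (tnth a)) <= 1].

(* The law lambda_n of a uniform element of the unit ball of the span of b,
   read in the coordinates given by b. *)
Definition uniform_law (A : set (RT n)) : \bar R :=
  (lebesgue_tuple n (A `&` unit_ball_coord) /
   lebesgue_tuple n unit_ball_coord)%E.

End unit_ball_law.

Variable k : nat.

(* The map with components L_i = \sum_(n >= 1) n^-2 phi_(i, n); functionals are
   indexed from 0, hence the n.+1. *)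
Definition series_map (phi : 'I_k -> nat -> B -> R^o) (x : B) : 'rV[R]_k :=
  \row_i limn (series (fun n => n.+1%:R ^- 2 * phi i n x : R^o)).

Definition E2 (V : nat -> set (B -> R^o)) : set (B -> 'rV[R]_k) :=
  [set series_map phi | phi in [set phi | forall i n, dual_ball (V n) (phi i n)]].

Variables (d : nat -> nat) (b : forall n, 'I_(d n) -> B -> R^o).

(* Families of coordinate vectors of the phi_(i, n), with the product
   sigma-algebra. *)
Definition coords := 'I_k -> forall n, RT (d n).

Definition coords_gen : set (set coords) :=
  [set C | exists i n (A : set (RT (d n))),
    measurable A /\ C = [set a | A (a i n)]].

Definition coordsType := g_sigma_algebraType coords_gen.

Definition map_of_coords (a : coords) : B -> 'rV[R]_k :=
  series_map (fun i n => lin_comb (@b n) (tnth (a i n))).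

(* mu is the product over all (i, n) of the laws lambda_n: these cylinders form
   a pi-system generating the sigma-algebra, so at most one probability
   qualifies. *)
Definition is_product_law (mu : probability coordsType R) : Prop :=
  forall (N : nat) (A : 'I_k -> forall n, set (RT (d n))),
    (forall i n, measurable (A i n)) ->
    mu [set a | forall i n, (n < N)%N -> A i n (a i n)] =
    (\prod_(i < k) \prod_(n < N) uniform_law (@b n) (A i n))%E.

End random_maps.

Section embeddings.
Context {R : realType} {B : normedModType R} {k : nat}.

Definition eucl_norm (v : 'rV[R]_k) : R :=
  Num.sqrt (\sum_(i < k) v 0 i ^+ 2).

Definition hoelder_on theta (A : set 'rV[R]_k) (g : 'rV[R]_k -> B) : Prop :=
  exists C : R, 0 < C /\ forall u v, A u -> A v ->
    `|g u - g v| <= C * eucl_norm (u - v) `^ theta.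

End embeddings.

(* Main.v *)
Require Import Defs.
From HB Require Import structures.
From mathcomp Require Import all_boot all_order all_algebra.
From mathcomp Require Import all_classical all_reals all_analysis.
From mathcomp Require Import measurable_realfun.
From mathcomp Require Import perm ring lra.
Set Implicit Arguments.
Unset Strict Implicit.
Unset Printing Implicit Defensive.
Import Order.TTheory GRing.Theory Num.Theory.
Import numFieldNormedType.Exports.
Local Open Scope classical_set_scope.
Local Open Scope ring_scope.

(* At scale eps = 2^-j, approximate X within delta, with delta^(1-t) ~ eps for
   some t slightly above the thickness, by a subspace of dimension
   n <= delta^(-t). The coordinate functionals of an almost Auerbach basis of
   this subspace, extended by Hahn-Banach, span V_j: every difference z of
   points of X with |z| >= eps / 2 has |psi z| >= eps / (12 n) for a psi in the
   unit ball of V_j. For a uniform phi in that ball, phi z then lies in a given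
   interval of length s with probability O(n s / (eps / n)); the k rows being
   independent, |L z| <= s has probability O((j^2 n^2 s / eps)^k) for every
   fixed z. With s = eps^(1/theta), the union bound over the pairs of an s-net
   of X, which has at most s^(-d) points, gives probabilities that are summable
   in j, precisely under the condition on theta. By Borel-Cantelli, almost
   every L satisfies |L x - L y| >= eps^(1/theta) whenever |x - y| >= eps, at
   all small scales. *)

(** * Countable products of probability measures *)

(** The net must be as fine as s = eps^(1/theta), not merely eps: the rows of L are Lipschitz with
    constant 2, so replacing x and y by net points changes L x - L y by a multiple of the mesh,
    which has to be comparable with s. Of the two factors n, one comes from the volume of slabs, the
    other from passing from |z| to a single coordinate functional; with n of order eps^(-t/(1-t))
    and s^(-2d) pairs, the total exponent of eps is positive exactly when theta k (1 + t) < (1 - t)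
    (k - 2d). The factors j^(2k) due to the weights are absorbed by the geometric decay. The basis
    of V_j that describes the law is arbitrary, so the slab estimate may use only that the ball is
    convex and symmetric. The bad events constrain partial sums of the series, truncated where the
    tail is below s; their measurability is then that of finite sums. The law is built as a
    countable product of spaces of varying dimension in which one coordinate can be integrated with
    all others frozen; independence is always used in this form. *)

Section cylinders.
Context {R : realType} {disp : measure_display} {I : countType}.
Variables (T : I -> measurableType disp) (P : forall i, probability (T i) R).
Local Open Scope ereal_scope.

Definition indexed_family := forall i, T i.

HB.instance Definition _ := gen_eqMixin indexed_family.
HB.instance Definition _ := gen_choiceMixin indexed_family.
HB.instance Definition _ := isPointed.Build indexed_family (fun i => point).

Definition coordinate_sets : set (set indexed_family) :=
  [set C | exists i (A : set (T i)), measurable A /\ C = [set a | A (a i)]].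

Definition familyType := g_sigma_algebraType coordinate_sets.

Definition update (a : indexed_family) i (t : T i) : indexed_family := eqtype.dfwith a t.

Lemma updateE (a : indexed_family) i (t : T i) : update a t i = t.
Proof. exact: dfwith_in. Qed.

Lemma update_other (a : indexed_family) i (t : T i) j : i != j -> update a t j = a j.
Proof. exact: dfwith_out. Qed.

Lemma measurable_coordinate i : measurable_fun setT (fun a : familyType => a i).
Proof.
move=> _ A mA; rewrite setTI; apply: sub_sigma_algebra.
by exists i, A.
Qed.

Lemma measurable_familyP d (S : measurableType d) (f : S -> familyType) :
  (forall i, measurable_fun setT (fun s => f s i)) -> measurable_fun setT f.
Proof.
move=> mf; apply: (@measurability _ _ _ _ setT f coordinate_sets) => //.
move=> _ [_ [i [A [mA ->]]] <-].
by apply: mf.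
Qed.

Lemma measurable_update i :
  measurable_fun setT (fun p : familyType * T i => update p.1 p.2 : familyType).
Proof.
apply: measurable_familyP => j; have [ij|ij] := eqVneq i j.
  subst j; apply: (eq_measurable_fun snd); last exact: measurable_snd.
  by move=> p _; rewrite updateE.
apply: (eq_measurable_fun (fun p : familyType * T i => p.1 j)).
  by move=> p _; rewrite update_other.
exact: (measurableT_comp (measurable_coordinate (i := j)) measurable_fst).
Qed.

Lemma measurable_updater i (a : familyType) :
  measurable_fun setT (fun t : T i => update a t : familyType).
Proof.
have m1 : measurable_fun setT (pair a : T i -> familyType * T i).
  exact: measurable_pair1.
exact: (measurableT_comp (measurable_update (i := i)) m1).
Qed.

Definition average i (f : familyType -> \bar R) : familyType -> \bar R :=
  fun a => \int[P i]_t f (update a t).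

(** Indices are treated in the order of their codes; a code that belongs to no index leaves [f]
    unchanged. *)
Definition step n (f : familyType -> \bar R) : familyType -> \bar R :=
  if pickle_inv n is Some i then average i f else f.

Definition regular (f : familyType -> \bar R) :=
  measurable_fun setT f /\ forall a, 0 <= f a.

Lemma regular_average i f : regular f -> regular (average i f).
Proof.
move=> [mf f0]; split; last by move=> a; apply: integral_ge0 => t _.
apply: (measurable_fun_fubini_tonelli_F
  (fun p : familyType * T i => f (update p.1 p.2))) => //.
exact: (measurableT_comp mf (measurable_update (i := i))).
Qed.

Lemma regular_step n f : regular f -> regular (step n f).
Proof. by rewrite /step; case: pickle_inv => // i; exact: regular_average. Qed.

Lemma regular_slice i f a : regular f ->
  measurable_fun setT (fun t : T i => f (update a t)).
Proof. by move=> [mf _]; exact: (measurableT_comp mf (measurable_updater a)). Qed.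

Lemma step_add n f g : regular f -> regular g ->
  step n (f \+ g) = step n f \+ step n g.
Proof.
move=> gf gg; rewrite /step; case: pickle_inv => // i.
apply/funext => a; rewrite /average/= ge0_integralD//.
- by move=> t _; apply: gf.2.
- exact: regular_slice.
- by move=> t _; apply: gg.2.
- exact: regular_slice.
Qed.

Lemma le_step n f g : regular f -> regular g -> (forall a, f a <= g a) ->
  forall a, step n f a <= step n g a.
Proof.
move=> gf gg fg a; rewrite /step; case: pickle_inv => // i.
apply: ge0_le_integral => //.
- by move=> t _; exact: gf.2.
- exact: regular_slice.
- exact: regular_slice.
Qed.

Definition depends (U : Type) N (f : familyType -> U) :=
  forall a b : familyType, (forall i, (pickle i < N)%N -> a i = b i) -> f a = f b.

Lemma depends_le (U : Type) N M (f : familyType -> U) :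
  (N <= M)%N -> depends N f -> depends M f.
Proof.
by move=> NM df a b ab; apply: df => i iN; apply: ab; exact: leq_trans NM.
Qed.

Lemma step_depends n f : depends n.+1 f -> depends n (step n f).
Proof.
move=> df; rewrite /step; case E: (pickle_inv n) => [i|].
  have iE : pickle i = n by have := pickle_invK (T := I) n; rewrite E.
  move=> a b ab; apply: eq_integral => t _; apply: df => j jn.
  have [ij|ij] := eqVneq i j; first by subst j; rewrite !updateE.
  rewrite !update_other//; apply: ab.
  rewrite ltn_neqAle -ltnS jn andbT -iE.
  by apply: contra_neq ij => /(pcan_inj pickleK).
move=> a b ab; apply: df => i; rewrite ltnS leq_eqVlt => /orP[/eqP iE|]; last exact: ab.
by move: E; rewrite -iE pickleK_inv.
Qed.

Lemma step_indep n f : depends n f -> regular f -> step n f = f.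
Proof.
move=> df gf; rewrite /step; case E: (pickle_inv n) => [i|//].
have iE : pickle i = n by have := pickle_invK (T := I) n; rewrite E.
apply/funext => a; rewrite /average.
rewrite (eq_integral (cst (f a))).
  by rewrite integral_cst//= [X in _ * X](probability_setT (P i)) mule1.
move=> t _; apply: df => j jn; rewrite update_other//.
by apply: contraTneq jn => <-; rewrite iE ltnn.
Qed.

(** Integrates out the codes $n, \dots, n+m-1$, the largest first: for [f] depending on the codes
    below $n+m$, this is the conditional expectation given the codes below [n]. *)
Fixpoint averages n m f := if m is m'.+1 then step n (averages n.+1 m' f) else f.

Lemma regular_steps n m f : regular f -> regular (averages n m f).
Proof. by move=> gf; elim: m n => //= m IH n; exact: regular_step. Qed.

Lemma averages_add n m f g : regular f -> regular g ->
  averages n m (f \+ g) = averages n m f \+ averages n m g.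
Proof.
move=> gf gg; elim: m n => //= m IH n.
by rewrite IH step_add//; exact: regular_steps.
Qed.

Lemma le_averages n m f g : regular f -> regular g -> (forall a, f a <= g a) ->
  forall a, averages n m f a <= averages n m g a.
Proof.
move=> gf gg fg; elim: m n => //= m IH n; apply: le_step => //; exact: regular_steps.
Qed.

Lemma averages_depends n m f : depends (n + m) f -> depends n (averages n m f).
Proof.
elim: m n => [|m IH] n /=; first by rewrite addn0.
by rewrite addnS -addSn => /IH; exact: step_depends.
Qed.

(** Averaging over a coordinate on which [f] does not depend changes nothing, since [P i] has mass
    1. This makes the content below independent of the number of coordinates used. *)
Lemma averages_extra n m k f : regular f -> depends (n + m) f ->
  averages n (m + k) f = averages n m f.
Proof.
move=> gf; elim: m n => [|m IH] n /= df; last by rewrite IH// addSn -addnS.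
elim: k n df => //= k IHk n df; rewrite add0n/= in IHk *.
rewrite addn0 in df; rewrite IHk; first exact: step_indep.
by rewrite addn0; exact: depends_le df.
Qed.

Lemma regular_indic (A : set familyType) : measurable A ->
  regular (fun a => (\1_A a)%:E).
Proof.
move=> mA; split; last by move=> a; rewrite lee_fin.
exact/measurable_EFinP/measurable_indic.
Qed.

(** * The algebra of cylinders and its content *)

Definition cylinder (A : set indexed_family) :=
  measurable (A : set familyType) /\
  exists N, depends N (A : familyType -> Prop).

Lemma cylinder0 : cylinder set0.
Proof. by split; [exact: measurable0|exists 0%N]. Qed.

Lemma cylinderC A : cylinder A -> cylinder (~` A).
Proof.
move=> [mA [N dA]]; split; first exact: measurableC.
by exists N => a b ab; rewrite /setC/= (dA a b).
Qed.

Lemma cylinderU : setU_closed cylinder.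
Proof.
move=> A B [mA [N dA]] [mB [M dB]]; split; first exact: measurableU.
exists (maxn N M) => a b ab; rewrite /setU/=.
rewrite (depends_le (leq_maxl N M) dA ab).
by rewrite (depends_le (leq_maxr N M) dB ab).
Qed.

Definition cylinder_display : measure_display. Proof. exact: default_measure_display. Qed.

Definition cylinderType : Type := indexed_family.
HB.instance Definition _ := Pointed.on cylinderType.
HB.instance Definition _ := @isAlgebraOfSets.Build cylinder_display cylinderType
  cylinder cylinder0 cylinderU cylinderC.

(** All coordinates on which the indicator depends are integrated out, so the value at [point] is
    the value everywhere. The bound picked by [cid] may be replaced by any other, by
    [cylinder_contentE]. *)
Definition cylinder_content (A : set cylinderType) : \bar R :=
  if pselect (exists N, depends N (A : familyType -> Prop)) is left h
  then averages 0%N (projT1 (cid h)) (fun a => (\1_A a)%:E) point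
  else 0.

Lemma depends_indic N (A : set familyType) : depends N (A : familyType -> Prop) ->
  depends N (fun a : familyType => (\1_A a)%:E : \bar R).
Proof. by move=> dA a b ab; rewrite !indicE /in_mem/= /in_set/= (dA a b). Qed.

Lemma cylinder_contentE N (A : set cylinderType) : measurable (A : set familyType) ->
  depends N (A : familyType -> Prop) ->
  cylinder_content A = averages 0%N N (fun a => (\1_A a)%:E) point.
Proof.
move=> mA dA; rewrite /cylinder_content; case: pselect; last by case; exists N.
move=> h; case: cid => M /= dM.
wlog: N M dA dM / (N <= M)%N.
  move=> H; have [NM|/ltnW MN] := leqP N M; first exact: H.
  by apply/esym; exact: H.
move=> NM; rewrite -(subnKC NM) averages_extra//; first exact: regular_indic.
exact: depends_indic.
Qed.

Lemma cylinder_content_ge0 A : 0 <= cylinder_content A.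
Proof.
rewrite /cylinder_content; case: pselect => // h; move: (projT1 _) => N.
have H n m f : (forall a, 0 <= f a) -> forall a, 0 <= averages n m f a.
  move=> f0; elim: m n => //= m IH n a; rewrite /step; case: pickle_inv => // i.
  by apply: integral_ge0 => t _.
by apply: H => a; rewrite lee_fin.
Qed.

Lemma cylinder_content0 : cylinder_content set0 = 0.
Proof.
rewrite (@cylinder_contentE 0)//=; by rewrite indicE in_set0.
Qed.

Lemma cylinder_contentT : cylinder_content setT = 1.
Proof. by rewrite (@cylinder_contentE 0)//= indicE in_setT. Qed.

Lemma cylinder_contentU (A B : set cylinderType) : cylinder A -> cylinder B ->
  A `&` B = set0 ->
  cylinder_content (A `|` B) = cylinder_content A + cylinder_content B.
Proof.
move=> [mA [N dA]] [mB [M dB]] AB0.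
have dA' := depends_le (leq_maxl N M) dA.
have dB' := depends_le (leq_maxr N M) dB.
rewrite (cylinder_contentE mA dA') (cylinder_contentE mB dB').
rewrite (@cylinder_contentE (maxn N M)); last 2 first.
- exact: measurableU.
- by move=> a b ab; rewrite /setU/= (dA' _ _ ab) (dB' _ _ ab).
rewrite [LHS](_ : _ = averages 0%N (maxn N M)
  ((fun a => (\1_A a)%:E) \+ (fun a => (\1_B a)%:E)) point).
  by rewrite averages_add//; exact: regular_indic.
congr (averages _ _ _ _); apply/funext => a /=; rewrite !indicE in_setU -EFinD.
case aA: (a \in A); case aB: (a \in B); rewrite ?addr0 ?add0r//.
by have : set0 a by rewrite -AB0; split; exact/set_mem.
Qed.


(** * Continuity of the content along increasing cylinders *)

Section continuity.
Variable B : (set cylinderType)^nat.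
Hypothesis cB : forall j, cylinder (B j).
Hypothesis ndB : forall j k, (j <= k)%N -> B j `<=` B k.

Let N j := projT1 (cid (cB j).2).
Let NP j : depends (N j) (B j : familyType -> Prop) := projT2 (cid (cB j).2).
Let ind j (a : familyType) : \bar R := (\1_(B j) a)%:E.
Let gind j : regular (ind j). Proof. by apply: regular_indic; exact: (cB j).1. Qed.
Let dind j : depends (N j) (ind j). Proof. exact: depends_indic. Qed.

(** The conditional content of [B j] given the codes below [n]; for $n \ge N_j$ it is the indicator
    of [B j]. *)
Let tail n j := averages n (N j - n) (ind j).
Let gtail n j : regular (tail n j). Proof. exact: regular_steps. Qed.

Let tailE n j M : (N j <= M)%N -> tail n j = averages n (M - n) (ind j).
Proof.
move=> NM; rewrite /tail -[in RHS](subnKC (leq_sub2r n NM)) averages_extra//.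
by apply: depends_le (@dind j); rewrite -maxnE leq_maxr.
Qed.

Let le_tail n j k a : (j <= k)%N -> tail n j a <= tail n k a.
Proof.
move=> jk; rewrite (tailE n (leq_maxl (N j) (N k))) (tailE n (leq_maxr (N j) (N k))).
apply: le_averages => // {}a; rewrite /ind lee_fin !indicE ler_nat.
case aB : (a \in B j) => //; rewrite lt0b; apply/mem_set.
by apply: (ndB jk); exact/set_mem.
Qed.

Let tail_step n j : tail n j = step n (tail n.+1 j).
Proof.
rewrite /tail; have [nN|Nn] := ltnP n (N j).
  by rewrite -(subnSK nN).
rewrite (eqP (Nn : _ == _)) (eqP (leqW Nn : _ == _))/= step_indep//.
exact: depends_le (@dind j).
Qed.

Let lim_tail n (a : familyType) := limn (tail n ^~ a).

Let cvg_tail n a : cvgn (tail n ^~ a).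
Proof. by apply: ereal_nondecreasing_is_cvgn => j k; exact: le_tail. Qed.

Let regular_lim n : regular (lim_tail n).
Proof.
split; last by move=> a; apply: lime_ge => //; apply: nearW => j; exact: (gtail _ _).2.
apply: (emeasurable_fun_cvg (fun j => tail n j)) => [j|a _]; first exact: (gtail _ _).1.
exact: cvg_tail.
Qed.

Let lim_step n : lim_tail n = step n (lim_tail n.+1).
Proof.
apply/funext => a; rewrite /lim_tail; under eq_fun do rewrite tail_step.
rewrite /step; case: pickle_inv => // i; rewrite /average monotone_convergence//.
- by move=> j; exact: regular_slice.
- by move=> j t _; exact: (gtail _ _).2.
- by move=> t _ j k; exact: le_tail.
Qed.

Let lim_depends n : depends n (lim_tail n).
Proof.
move=> a b ab; rewrite /lim_tail; congr (limn _); apply/funext => j.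
apply: (averages_depends (m := N j - n)) ab.
by apply: depends_le (@dind j); rewrite -maxnE leq_maxr.
Qed.

(** If the next limit were at least 1 for every value of the coordinate of code [n], so would be its
    average, which is [lim_tail n a] by [lim_step]. *)
Let extend n a : lim_tail n a < 1 -> exists b : familyType,
  lim_tail n.+1 b < 1 /\ forall i, pickle i != n -> b i = a i.
Proof.
rewrite lim_step /step; case E : (pickle_inv n) => [i|]; last by exists a.
have iE : pickle i = n by have := pickle_invK (T := I) n; rewrite E.
move=> lt1; suff [t lt1t] : exists t : T i, lim_tail n.+1 (update a t : familyType) < 1.
  exists (update a (t : T i)); split => // j jn; rewrite update_other//.
  by apply: contra_neq jn => <-.
apply: contrapT => /forallNP ge1; move: lt1; apply/negP; rewrite -leNgt.
rewrite /average.
have <- : \int[P i]_t (cst 1%E t) = 1.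
  by rewrite integral_cst//= [X in _ * X](probability_setT (P i)) mule1.
apply: ge0_le_integral => //; first exact: regular_slice.
by move=> t _; rewrite leNgt; apply/negP; exact: ge1.
Qed.

Let next n (a : familyType) : familyType :=
  xget a [set b | lim_tail n.+1 b < 1 /\ forall i, pickle i != n -> b i = a i].

Let nextP n a : lim_tail n a < 1 ->
  lim_tail n.+1 (next n a) < 1 /\ forall i, pickle i != n -> next n a i = a i.
Proof. by move=> /extend[b bP]; rewrite /next; case: xgetP => [c _ []//|/(_ b)]. Qed.

Fixpoint orbit_point n : familyType := if n is m.+1 then next m (orbit_point m) else point.

(* If the limit were [< 1], choosing the coordinates one at a time with all the
   conditional limits [< 1] would produce a point outside every [B j]. *)
Lemma cylinder_content_cvg1 : (forall a, exists j, B j a) ->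
  cylinder_content (B j) @[j --> \oo] --> 1.
Proof.
move=> covB.
have contentE j : cylinder_content (B j) = tail 0%N j point.
  by rewrite /tail subn0 (cylinder_contentE _ (@NP j))//; exact: (cB j).1.
under eq_fun do rewrite contentE.
suff : lim_tail 0%N point = 1 by move=> <-; exact: cvg_tail.
apply/eqP; rewrite eq_le; apply/andP; split.
  apply: lime_le => //; apply: nearW => j.
  rewrite -contentE -(@cylinder_contentT) -[leLHS]adde0.
  rewrite -(setvU (B j)) setUC cylinder_contentU ?setICr//; last exact: cylinderC.
  by apply: leeD => //; exact: cylinder_content_ge0.
rewrite leNgt; apply/negP => lt1.
have oP n : lim_tail n (orbit_point n) < 1.
  by elim: n => //= n /nextP[].
have oE n i m : (pickle i < n)%N -> orbit_point (n + m) i = orbit_point n i.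
  move=> iN; elim: m => [|m IH]; rewrite ?addn0// addnS/=.
  rewrite (nextP (oP _)).2//; apply: contraTneq iN => ->.
  by rewrite -leqNgt leq_addr.
(* Stages after [pickle i] leave coordinate [i] alone, so this diagonal point agrees with
   [orbit_point n] on the codes below [n]. *)
pose a : familyType := fun i => orbit_point (pickle i).+1 i.
have aP n : lim_tail n a < 1.
  rewrite (@lim_depends n a (orbit_point n))// => i iN.
  by rewrite /a -(subnKC iN) oE.
have [j Bja] := covB a; have := aP (N j); apply/negP; rewrite -leNgt.
(* At stage [N j] the conditional content of [B j] is its indicator, which is 1 at [a]; this
   contradicts [aP]. *)
have -> : 1 = tail (N j) j a by rewrite /tail subnn/= /ind indicE mem_set.
apply: lime_ge => //; exists j => // k /= jk; exact: le_tail.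
Qed.

End continuity.

Lemma cylinder_content_bigcup (F : (set cylinderType)^nat) n :
  (forall i, cylinder (F i)) -> trivIset setT F ->
  cylinder (\big[setU/set0]_(i < n) F i) /\
  cylinder_content (\big[setU/set0]_(i < n) F i) =
    \sum_(0 <= i < n) cylinder_content (F i).
Proof.
move=> cF tF; elim: n => [|n [IH1 IH2]].
  by rewrite big_ord0 big_geq// cylinder_content0; split => //; exact: cylinder0.
rewrite big_ord_recr big_nat_recr//=; split; first exact: cylinderU.
rewrite cylinder_contentU// ?IH2//.
rewrite -bigcup_mkord setI_bigcupl bigcup0// => i/= ni.
by move/trivIsetP : tF => /(_ i n Logic.I Logic.I); apply; rewrite ltn_eqF.
Qed.

(** The partial unions, joined with the complement of the whole union, are cylinders that increase
    to the full space; their contents tend to 1, and finite additivity does the rest. *)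
Lemma cylinder_content_sigma_additive :
  semi_sigma_additive cylinder_content.
Proof.
move=> F cF tF cUF.
pose U := \bigcup_n F n.
have cB n : cylinder ((\big[setU/set0]_(i < n) F i) `|` ~` U).
  by apply: cylinderU; [exact: (cylinder_content_bigcup n cF tF).1|exact: cylinderC].
have UUE : cylinder_content U + cylinder_content (~` U) = 1.
  by rewrite -cylinder_contentU// ?setICr//; [rewrite setUv cylinder_contentT|exact: cylinderC].
have Ufin : cylinder_content (~` U) \is a fin_num.
  rewrite ge0_fin_numE ?cylinder_content_ge0// (@le_lt_trans _ _ 1) ?ltry//.
  by rewrite -UUE leeDr// cylinder_content_ge0.
have BE n : cylinder_content ((\big[setU/set0]_(i < n) F i) `|` ~` U) =
    \sum_(0 <= i < n) cylinder_content (F i) + cylinder_content (~` U).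
  have [c e] := cylinder_content_bigcup n cF tF.
  rewrite cylinder_contentU// ?e//; first exact: cylinderC.
  rewrite -subset0 => a [+ Ua]; rewrite -bigcup_mkord => -[i _ Fia].
  by apply: Ua; exists i.
have ndB j k : (j <= k)%N -> (\big[setU/set0]_(i < j) F i) `|` ~` U `<=`
    (\big[setU/set0]_(i < k) F i) `|` ~` U.
  by move=> jk; apply: setSU; exact: subset_bigsetU.
have covB a : exists j, ((\big[setU/set0]_(i < j) F i) `|` ~` U) a.
  have [[i _ Fia]|nUa] := pselect (U a); last by exists 0%N; right.
  by exists i.+1; left; rewrite -bigcup_mkord; exists i => /=.
have := cylinder_content_cvg1 cB ndB covB; under eq_fun do rewrite BE.
have defB : 1 +? - cylinder_content (~` U) by rewrite fin_num_adde_defl// fin_numN.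
move=> /(cvgeB defB)/(_ (cvg_cst (cylinder_content (~` U)))).
rewrite -UUE addeK// => cv; rewrite -[cylinder_content (\bigcup_n _)]/(cylinder_content U).
by apply: cvg_trans cv; apply: near_eq_cvg; apply: nearW => n /=; rewrite addeK.
Qed.



HB.instance Definition _ := isMeasure.Build _ cylinderType R cylinder_content
  cylinder_content0 cylinder_content_ge0 cylinder_content_sigma_additive.

(** * Extension to the product sigma-algebra *)

Definition product_law (A : set familyType) : \bar R :=
  mu_ext cylinder_content (A : set cylinderType).

Lemma cylinder_coordinate i (A : set (T i)) : measurable A ->
  cylinder [set a | A (a i)].
Proof.
move=> mA; split; first by apply: sub_sigma_algebra; exists i, A.
by exists (pickle i).+1 => a b ab; rewrite /mkset ab.
Qed.

(** The sets that generate the product sigma-algebra are cylinders, so the Caratheodory extension of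
    the content is countably additive on it. *)
Lemma measurable_cylinderW (A : set familyType) : measurable A ->
  <<s (@measurable _ cylinderType) >> A.
Proof.
apply: smallest_sub; first exact: smallest_sigma_algebra.
move=> _ [i [C [mC ->]]]; apply: sub_sigma_algebra.
exact: cylinder_coordinate.
Qed.

Lemma product_law0 : product_law set0 = 0.
Proof. exact: mu_ext0. Qed.

Lemma product_law_ge0 A : 0 <= product_law A.
Proof. exact: mu_ext_ge0. Qed.

Lemma product_law_sigma_additive : semi_sigma_additive product_law.
Proof.
move=> F mF tF mUF.
apply: (@measure_semi_sigma_additive _ _ _ (measure_extension cylinder_content)) => //.
- by move=> i; exact: measurable_cylinderW.
- exact: measurable_cylinderW.
Qed.

HB.instance Definition _ := isMeasure.Build _ familyType R product_law
  product_law0 product_law_ge0 product_law_sigma_additive.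

Lemma product_lawE (A : set familyType) : cylinder A ->
  product_law A = cylinder_content A.
Proof. by move=> cA; rewrite /product_law measurable_mu_extE. Qed.

Lemma product_lawT : product_law setT = 1.
Proof.
rewrite product_lawE ?cylinder_contentT//.
by rewrite -setC0; apply: cylinderC; exact: cylinder0.
Qed.

HB.instance Definition _ :=
  Measure_isProbability.Build _ familyType R product_law product_lawT.

(** * Rectangles, and resampling of one coordinate *)

Definition rectangle N (A : forall i, set (T i)) : set familyType :=
  [set a | forall i, (pickle i < N)%N -> A i (a i)].

Let weight (A : forall i, set (T i)) n : \bar R :=
  if pickle_inv n is Some i then P i (A i) else 1.

Let rectangleS N A : rectangle N.+1 A = rectangle N A `&`
  [set a | if pickle_inv N is Some i then A i (a i) else True].
Proof.
apply/seteqP; split=> [a aA|a [aA aN] i].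
  split=> [i iN|/=]; first by apply: aA; exact: leqW.
  have := pickle_invK (T := I) N; case: pickle_inv => //= i iN.
  by apply: aA; rewrite iN.
rewrite ltnS leq_eqVlt => /orP[/eqP iN|]; last exact: aA.
by move: aN => /=; rewrite -iN pickleK_inv.
Qed.

Lemma cylinder_rectangle N A : (forall i, measurable (A i)) ->
  cylinder (rectangle N A).
Proof.
move=> mA; split; last first.
  exists N => a b ab; apply/propext; split => + i iN => /(_ i iN).
    by rewrite ab.
  by rewrite ab.
elim: N => [|N IH].
  by rewrite (_ : rectangle _ _ = setT)//; apply/seteqP; split.
rewrite rectangleS; apply: measurableI => //.
case: pickle_inv => [i|]; last exact: measurableT.
exact: (cylinder_coordinate (mA i)).1.
Qed.

Let averages_rectangle N A : (forall i, measurable (A i)) -> forall m n, (n + m = N)%N ->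
  averages n m (fun a => (\1_(rectangle N A) a)%:E) =
  fun a => (\1_(rectangle n A) a)%:E * \prod_(n <= j < N) weight A j.
Proof.
move=> mA; elim=> [|m IH] n nmN.
  by apply/funext => a; rewrite -nmN addn0 big_geq// mule1.
rewrite /= IH; last by rewrite addSn -addnS.
apply/funext => a; rewrite (@big_ltn _ _ _ n) ?(leq_trans _ (leq_addr m n.+1)) ?addSnnS ?nmN//; last first.
  by rewrite -nmN addnS ltnS leq_addr.
set c := (X in _ * (_ * X)); have c0 : 0 <= c.
  by apply: prode_ge0 => j; rewrite /weight; case: pickle_inv => // i.
rewrite /step /weight.
have := rectangleS n A; have := pickle_invK (T := I) n.
case: pickle_inv => [i|] /= iE ->; last by rewrite setIT mul1e.
rewrite /average (eq_integral (fun t =>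
    ((\1_(rectangle n A) a)%:E * c) * (\1_(A i) t)%:E)); last first.
  move=> t _; rewrite muleAC; congr (_ * _).
  rewrite -EFinM; congr (_%:E); rewrite !indicE in_setI -natrM mulnb.
  congr ((_ && _)%:R).
    rewrite /in_mem/= /in_set/=; congr (`[< _ >]); apply/propext.
    split=> H j jn; move: (H j jn); rewrite update_other//; by apply: contraTneq jn => <-; rewrite iE ltnn.
  by rewrite /in_mem/= /in_set/= updateE.
rewrite ge0_integralZl//; last by rewrite mule_ge0.
- by rewrite integral_indic// setIT muleAC muleA.
- exact/measurable_EFinP/measurable_indic.
Qed.

Lemma product_law_rectangle N A : (forall i, measurable (A i)) ->
  product_law (rectangle N A) = \prod_(0 <= j < N) weight A j.
Proof.
move=> mA; have [mR _] := cylinder_rectangle N mA.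
rewrite product_lawE; last exact: cylinder_rectangle.
rewrite (@cylinder_contentE N)//; last first.
  move=> a b ab; apply/propext; split => + i iN => /(_ i iN).
    by rewrite ab.
  by rewrite ab.
by rewrite averages_rectangle// indicE mem_set ?mul1e// => i.
Qed.

Lemma setI_closed_rectangle : setI_closed
  [set C | exists N A, (forall i, measurable (A i)) /\ C = rectangle N A].
Proof.
move=> _ _ [N [A [mA ->]]] [M [A' [mA' ->]]].
exists (maxn N M), (fun i => (if (pickle i < N)%N then A i else setT) `&`
                         (if (pickle i < M)%N then A' i else setT)); split.
  by move=> i; apply: measurableI; case: ifP.
apply/seteqP; split=> [a [aA aA'] i _|a H].
  by split; case: ifP => // ?; [exact: aA|exact: aA'].
split=> i iN; have := H i; rewrite leq_max iN ?orbT; first by case.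
by case.
Qed.

(** Redrawing coordinate [i] independently preserves the law: both sides are measures in [A] that
    agree on rectangles, a generating pi-system. The independence statements below follow from this
    Fubini identity. *)
Lemma product_law_resample i (A : set familyType) : measurable A ->
  product_law A = \int[product_law]_a P i [set t | A (update a t)].
Proof.
move=> mA.
pose mu' := pushforward (product_law \x P i)%E
  (fun p : familyType * T i => update p.1 p.2 : familyType).
pose G := [set C | exists N A, (forall i, measurable (A i)) /\ C = rectangle N A].
have mU := @measurable_update i.
rewrite [RHS](_ : _ = mu' A); last first.
  rewrite /mu' /pushforward/= /product_measure1; apply: eq_integral => a _ /=.
  by congr (P i _); apply/seteqP; split=> t /=; rewrite /xsection/= in_setE.
have muE N B : (forall i, measurable (B i)) -> product_law (rectangle N B) = mu' (rectangle N B).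
  move=> mB; rewrite /mu' /pushforward.
  (* The new value overwrites coordinate [i], so the side of the rectangle at [i] constrains that
     value only. *)
  pose B' j := if j == i then setT else B j.
  pose Bi := if (pickle i < N)%N then B i else setT.
  have mB' j : measurable (B' j) by rewrite /B'; case: ifP.
  have mBi : measurable Bi by rewrite /Bi; case: ifP.
  rewrite [X in (_ \x _)%E X](_ : _ = rectangle N B' `*` Bi); last first.
    apply/seteqP; split=> [[a t] H|[a t] [H1 H2] j jN] /=.
      split=> /=; last by rewrite /Bi; case: ifP => // iN; have := H i iN; rewrite /= updateE.
      move=> j jN; rewrite /B'; have [//|ji] := eqVneq j i.
      by have := H j jN; rewrite /= update_other// eq_sym.
    have [ji|ji] := eqVneq j i; last first.
      by have := H1 j jN; rewrite /= update_other 1?eq_sym// /B' (negbTE ji).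
    by subst j; rewrite updateE; move: H2; rewrite /= /Bi jN.
  rewrite product_measure1E//; last exact: (cylinder_rectangle N mB').1.
  rewrite [X in _ = X * _](product_law_rectangle N mB') product_law_rectangle//.
  have wB' j : j != pickle i -> weight B' j = weight B j.
    rewrite /weight => ji; have := pickle_invK (T := I) j.
    by case: pickle_inv => //= l lE; rewrite /B'; case: eqP => // li; move: ji; rewrite -lE li eqxx.
  have wBi : weight B' (pickle i) = 1.
    by rewrite /weight pickleK_inv /B' eqxx [LHS](probability_setT (P i)).
  rewrite !big_mkord /Bi; case: ifPn => iN; last first.
    rewrite [X in _ = _ * X](probability_setT (P i)) mule1.
    apply: eq_bigr => j _; rewrite wB'//; apply: contraNneq iN => <-; exact: ltn_ord.
  rewrite (bigD1 (Ordinal iN))//= [in RHS](bigD1 (Ordinal iN))//= wBi mul1e muleC.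
  have -> : weight B (pickle i) = P i (B i) by rewrite /weight pickleK_inv.
  congr (_ * _).
  by apply: eq_bigr => j ji; rewrite wB'.
apply: (@measure_unique _ _ _ G (fun=> setT) _ _ _ _ product_law mu') => //.
- apply/seteqP; split; last first.
    apply: smallest_sub; first exact: smallest_sigma_algebra.
    by move=> _ [N [B [mB ->]]]; exact: (cylinder_rectangle N mB).1.
  apply: smallest_sub; first exact: smallest_sigma_algebra.
  move=> _ [j [C [mC ->]]]; apply: sub_sigma_algebra.
  exists (pickle j).+1.
  pose B := eqtype.dfwith (fun l => [set: T l]) C : forall l, set (T l).
  exists B; split=> [l|]; first by rewrite /B; case: eqtype.dfwithP.
  apply/seteqP; split=> [a Ca l lj|a H]; last first.
    by have := H j (ltnSn _); rewrite /B eqtype.dfwith_in.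
  rewrite /B; have [jl|jl] := eqVneq j l; last by rewrite eqtype.dfwith_out.
  by subst l; rewrite eqtype.dfwith_in.
- exact: setI_closed_rectangle.
- move=> _; exists 0%N, (fun=> setT); split => //.
  by apply/seteqP; split.
- by rewrite bigcup_const.
- by move=> _ [N [B [mB ->]]]; exact: muE.
- by move=> _; rewrite [ltLHS]product_lawT ltry.
Qed.


Lemma measurable_update_section i a (A : set familyType) : measurable A ->
  measurable [set t : T i | A (update a t)].
Proof. by move=> mA; rewrite -[X in measurable X]setTI; exact: measurable_updater. Qed.

Lemma measurable_section_law i (A : set familyType) : measurable A ->
  measurable_fun setT (fun a : familyType => P i [set t : T i | A (update a t)]).
Proof.
move=> mA; have [mav _] := regular_average i (regular_indic mA).
apply: eq_measurable_fun mav => a _; rewrite /average.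
rewrite -[X in P i X]setIT -integral_indic//.
exact: measurable_update_section.
Qed.

Lemma product_law_setI i (A : set (T i)) (B : set familyType) :
  measurable A -> measurable B -> (forall a (t : T i), B (update a t) <-> B a) ->
  product_law ([set a | A (a i)] `&` B) = P i A * product_law B.
Proof.
move=> mA mB updB; rewrite (@product_law_resample i); last first.
  by apply: measurableI => //; exact: (cylinder_coordinate mA).1.
under eq_integral => a _.
  rewrite (_ : P i _ = P i A * (\1_B a)%:E); last first.
    rewrite indicE; case: (boolP (a \in B)) => [/set_mem|/negP] aB; rewrite ?(mule1, mule0).
      congr (P i _); apply/seteqP; split=> t /=; rewrite updateE; first by case.
      by move=> At; split => //; apply/updB.
    rewrite (_ : [set _ | _] = set0) ?measure0//; apply/seteqP; split=> t //= [_ /updB].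
    by move/mem_set/aB.
  over.
rewrite ge0_integralZl//; last exact/measurable_EFinP/measurable_indic.
by rewrite integral_indic// setIT.
Qed.

(** [A] may depend on all coordinates: it is enough that its section in coordinate [i] has
    probability at most [q] whatever the others are, while [B] ignores coordinate [i]. *)
Lemma product_law_setI_le i (q : \bar R) (A B : set familyType) :
  measurable A -> measurable B -> (forall a (t : T i), B (update a t) <-> B a) ->
  0 <= q -> (forall a, P i [set t : T i | A (update a t)] <= q) ->
  product_law (A `&` B) <= q * product_law B.
Proof.
move=> mA mB updB q0 Aq; rewrite (@product_law_resample i); last exact: measurableI.
apply: (@le_trans _ _ (\int[product_law]_a (q * (\1_B a)%:E))).
  have mind : measurable_fun setT (fun a : familyType => (\1_B a)%:E : \bar R).
    exact/measurable_EFinP/measurable_indic.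
  apply: ge0_le_integral => //.
  - by apply: measurable_section_law; exact: measurableI.
  - exact: measurable_funeM.
  move=> a _; rewrite indicE; case: (boolP (a \in B)) => [/set_mem|/negP] aB; rewrite ?(mule1, mule0).
    apply: le_trans (Aq a); apply: le_measure; rewrite ?inE.
    - by apply: measurable_update_section; exact: measurableI.
    - exact: measurable_update_section.
    - by move=> t [].
  rewrite (_ : [set _ | _] = set0) ?measure0//; apply/seteqP; split=> t //= [_ /updB].
  by move/mem_set/aB.
rewrite ge0_integralZl//; last exact/measurable_EFinP/measurable_indic.
by rewrite integral_indic// setIT.
Qed.

Lemma product_law_coordinates (s : seq I) (A : forall i, set (T i)) :
  (forall i, measurable (A i)) -> uniq s ->
  product_law [set a | forall i, i \in s -> A i (a i)] = \prod_(i <- s) P i (A i).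
Proof.
move=> mA; elim: s => [_|i s IH /= /andP[si us]].
  by rewrite big_nil (_ : [set _ | _] = setT) ?product_lawT//; apply/seteqP; split.
rewrite big_cons -IH// -product_law_setI//.
- congr product_law; apply/seteqP; split=> [a H|a [Ha H] j].
    split; first by apply: H; rewrite mem_head.
    by move=> j js; apply: H; rewrite inE js orbT.
  by rewrite inE => /predU1P[->//|]; exact: H.
- rewrite (_ : [set _ | _] = \bigcap_(j in [set` s]) [set a | A j (a j)]).
    apply: fin_bigcap_measurable; first exact: finite_seq.
    by move=> j _; exact: (cylinder_coordinate (mA j)).1.
  by apply/seteqP; split.
- by move=> a t; split=> H j js; move: (H j js); rewrite update_other//;
    apply: contraNneq si => ->.
Qed.

End cylinders.

(** * Lebesgue measure on tuples *)

Section lebesgue_affine.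
Context {R : realType}.
Local Open Scope ereal_scope.
Local Notation mu := (@lebesgue_measure R).

Lemma measurable_affine (r v : R) :
  measurable_fun setT (fun x : measurableTypeR R => (r * x + v)%R : measurableTypeR R).
Proof.
by apply: measurable_funD; [apply: measurable_funM|]; exact: measurable_cst || exact: measurable_id.
Qed.

Lemma lebesgue_measure_affine (r v : R) (A : set (measurableTypeR R)) :
  (0 < r)%R -> measurable A ->
  mu ((fun x => (r * x + v)%R) @^-1` A) = (r^-1)%:E * mu A.
Proof.
move=> r0 mA.
have r0' : (0 <= r)%R by exact: ltW.
pose f := (fun x => (r * x + v)%R) : measurableTypeR R -> measurableTypeR R.
have mf : measurable_fun setT f := measurable_affine r v.
pose nu := mscale (NngNum r0') (pushforward mu f).
have -> : mu A = nu mf A.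
  apply: lebesgue_measure_unique => // _ [[a b]] _ <-.
  have E : f @^-1` `]a, b]%classic = `](r^-1 * (a - v))%R, (r^-1 * (b - v))%R]%classic.
    apply/seteqP; split=> x /=; rewrite !in_itv/= /f ltr_pdivrMl// ler_pdivlMl//;
      by rewrite -ltrBlDr -lerBrDr.
  rewrite -[RHS]/(r%:E * mu (f @^-1` `]a, b]%classic)) E.
  rewrite !lebesgue_measure_itv/= !lte_fin ltr_pM2l ?invr_gt0// ltrD2r.
  case: ifPn => // _; rewrite ?mule0// -!EFinB -EFinM; congr (_%:E).
  by rewrite -mulrBr mulrA mulfV ?gt_eqF// mul1r opprB addrA subrK.
by rewrite /nu /mscale/= muleA -EFinM mulVf ?gt_eqF// mul1e.
Qed.

Lemma integral_affine (r v : R) (f : measurableTypeR R -> \bar R) : (0 < r)%R ->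
  measurable_fun setT f -> (forall x, 0 <= f x) ->
  \int[mu]_x f (r * x + v)%R = (r^-1)%:E * \int[mu]_x f x.
Proof.
move=> r0 mf f0.
have r0' : (0 <= r^-1)%R by rewrite invr_ge0 ltW.
have := @ge0_integral_pushforward _ _ _ _ _ _ (measurable_affine r v) mu setT f.
rewrite /= preimage_setT => <- //.
rewrite -[RHS](ge0_integral_mscale mu measurableT (NngNum r0'))//.
apply: eq_measure_integral => [|mf' A mA _]; first exact: measurable_affine.
exact: lebesgue_measure_affine.
Qed.

Local Notation RT n := (n.-tuple (measurableTypeR R)).

Definition affine_tuple n (r : R) (v a : RT n) : RT n :=
  [tuple (r * tnth a i + tnth v i)%R | i < n].

Lemma measurable_affine_tuple n (r : R) (v : RT n) :
  measurable_fun setT (affine_tuple r v).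
Proof.
apply/measurable_fun_tnthP => i.
apply: (eq_measurable_fun (fun a : RT n => (r * tnth a i + tnth v i)%R : measurableTypeR R)).
  by move=> a _; rewrite /= tnth_mktuple.
exact: (measurableT_comp (measurable_affine r (tnth v i)) (measurable_tnth i)).
Qed.

Lemma measurable_cons_fix n (x : R) :
  measurable_fun setT (fun t : RT n => cons_pair (x, t)).
Proof. by apply: measurable_cons; [exact: measurable_cst|exact: measurable_id]. Qed.

Lemma lebesgue_tupleS n (A : set (RT n.+1)) : lebesgue_tuple n.+1 A =
  \int[mu]_x lebesgue_tuple n [set t | A (cons_pair (x, t))].
Proof.
rewrite /= /lebesgue_step/= /pushforward /product_measure1; apply: eq_integral => x _ /=.
by congr (lebesgue_tuple n _); apply/seteqP; split=> t /=; rewrite /xsection/= in_setE.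
Qed.

Lemma measurable_cons_section n (A : set (RT n.+1)) : measurable A ->
  measurable_fun setT (fun x : measurableTypeR R => lebesgue_tuple n [set t | A (cons_pair (x, t))]).
Proof.
move=> mA.
have mA' : measurable (@cons_pair R n @^-1` A).
  by rewrite -[X in measurable X]setTI; exact: measurable_cons_pair.
have := measurable_fun_xsection (lebesgue_tuple n) mA'.
apply: eq_measurable_fun => x _ /=.
by congr (lebesgue_tuple n _); apply/seteqP; split=> t /=; rewrite /xsection/= in_setE.
Qed.

(** Induction on the dimension, slicing along the first coordinate. It serves to compute the volume
    of contracted slabs. *)
Lemma lebesgue_tuple_affine n (r : R) (v : RT n) (A : set (RT n)) :
  (0 < r)%R -> measurable A ->
  lebesgue_tuple n (affine_tuple r v @^-1` A) = ((r^-1) ^+ n)%:E * lebesgue_tuple n A.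
Proof.
move=> r0; elim: n v A => [|n IH] v A mA.
  by rewrite expr0 mul1e; congr (\d_ _ _); apply/seteqP; split=> a /=; rewrite !(tuple0 a) (tuple0 (affine_tuple _ _ _)).
rewrite !lebesgue_tupleS.
have E x t : affine_tuple r v (cons_pair (x, t)) =
    cons_pair ((r * x + thead v)%R, affine_tuple r [tuple of behead v] t).
  apply: eq_from_tnth => i; rewrite tnth_mktuple.
  have [->|[j ->]] : i = ord0 \/ exists j, i = lift ord0 j.
    by case: (unliftP ord0 i) => [j ->|->]; [right; exists j|left].
  - by rewrite !tnth0.
  - by rewrite !tnthS tnth_mktuple tnth_behead; congr (_ + tnth v _)%R; apply/val_inj; rewrite /= inordK// ltnS.
transitivity (\int[mu]_x (((r^-1) ^+ n)%:E * lebesgue_tuple n [set t | A (cons_pair ((r * x + thead v)%R, t))])).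
  apply: eq_integral => x _; rewrite -(IH [tuple of behead v]).
    by congr (lebesgue_tuple n _); apply/seteqP; split=> t /=; rewrite E.
  by rewrite -[X in measurable X]setTI; exact: measurable_cons_fix.
have mS := measurable_cons_section mA.
rewrite ge0_integralZl//; last 2 first.
- exact: (measurableT_comp mS (measurable_affine r (thead v))).
- by rewrite lee_fin exprn_ge0// invr_ge0 ltW.
rewrite (integral_affine (thead v) r0 mS)// muleA -EFinM; congr (_%:E * _).
by rewrite exprSr.
Qed.

Definition cube n (r : R) : set (RT n) :=
  [set a | forall i, (`|tnth a i| <= r)%R].

Lemma lebesgue_tuple_cube n (r : R) : (0 <= r)%R ->
  lebesgue_tuple n (cube r) = ((2 * r) ^+ n)%:E.
Proof.
move=> r0; elim: n => [|n IH].
  by rewrite /= /dirac indicE mem_set// => -[].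
rewrite lebesgue_tupleS.
transitivity (\int[mu]_(x in `[(- r)%R, r]) ((2 * r) ^+ n)%:E).
  rewrite [RHS]integral_mkcond; apply: eq_integral => x _; rewrite patchE.
  case: ifPn => xr.
    rewrite -IH; congr (lebesgue_tuple n _); apply/seteqP; split=> t /= H i.
      by have := H (lift ord0 i); rewrite tnthS.
    case: (unliftP ord0 i) => [j ->|->]; first by rewrite tnthS.
    by rewrite tnth0 /= ler_norml; move: xr; rewrite inE/= in_itv.
  rewrite (_ : [set _ | _] = set0) ?measure0//; apply/seteqP; split=> t // H.
  move: xr; rewrite notin_setE/= in_itv/= -ler_norml; apply.
  by have := H ord0; rewrite tnth0.
rewrite integral_cst//= lebesgue_measure_itv/= lte_fin; case: ifPn => [_|].
  by rewrite -EFinB -EFinM opprK -mulr2n -[(r *+ 2)%R]mulr_natl exprSr.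
rewrite -leNgt => rr; have -> : r = 0%R by apply/eqP; rewrite eq_le r0 andbT; move: rr; lra.
by rewrite mule0 mulr0 expr0n.
Qed.

End lebesgue_affine.

(** * Finite-dimensional norms and the Hahn-Banach theorem *)

Section norm_equivalence.
Context {R : realType}.

Lemma coord_le_norm n (u : 'rV[R]_n) i : `|u ord0 i| <= `|u|.
Proof.
rewrite [leRHS]/Num.norm/= mx_normrE; apply/bigmax_geP; right => /=.
by exists (ord0, i).
Qed.

(** [N] is continuous, being dominated by the sum of its values on the standard basis, so it attains
    a positive minimum on the compact unit sphere. [N] is an abstract function because it will be
    the norm of a subspace read in coordinates. *)
Lemma norm_coord_le n (N : 'rV[R]_n -> R) :
  (forall u v, N (u + v) <= N u + N v) ->
  (forall a u, N (a *: u) = `|a| * N u) ->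
  (forall u, N u = 0 -> u = 0) ->
  exists2 m, 0 < m & forall (u : 'rV[R]_n) i, m * `|u ord0 i| <= N u.
Proof.
case: n N => [|n] N ND NZ N0; first by exists 1 => // u [].
have N00 : N 0 = 0 by have := NZ 0 0; rewrite scale0r normr0 mul0r.
have NN u : N (- u) = N u by rewrite -scaleN1r NZ normrN1 mul1r.
have N_ge0 u : 0 <= N u.
  by have := ND u (- u); rewrite subrr N00 NN -mulr2n pmulrn_lge0.
pose M := \sum_i N (delta_mx ord0 i).
have NM u : N u <= M * `|u|.
  rewrite [X in N X]row_sum_delta.
  apply: (@le_trans _ _ (\sum_i N (u ord0 i *: delta_mx ord0 i))).
    elim/big_ind2 : _ => [|x a y b ax yb|]; rewrite ?N00//.
    by rewrite (le_trans (ND _ _))// lerD.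
  rewrite mulr_suml; apply: ler_sum => i _; rewrite NZ mulrC ler_wpM2l//.
  exact: coord_le_norm.
have cN : continuous N.
  have M0 : 0 <= M by apply: sumr_ge0.
  move=> u; apply/(@cvgrPdist_lt _ _ _ (nbhs u)) => e e0.
  apply/(@nbhs_normP R 'rV[R]_n.+1).
  exists (e / (M + 1)) => /=; first by rewrite divr_gt0// ltr_wpDl.
  move=> v /=; rewrite ltr_pdivlMr ?ltr_wpDl// => uve.
  apply: le_lt_trans uve; rewrite mulrDr mulr1 mulrC.
  apply: (@le_trans _ _ (M * `|u - v|)); last by rewrite lerDl.
  rewrite ler_norml; apply/andP; split.
    rewrite lerNl opprB lerBlDr -{1}(subrK u v) (le_trans (ND _ _))// lerD2r.
    by rewrite -NN opprB NM.
  by rewrite lerBlDr -{1}(subrK v u) (le_trans (ND _ _))// lerD2r NM.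
pose S := [set u : 'rV[R]_n.+1 | `|u| = 1].
have cS : compact S.
  apply: bounded_closed_compact.
    by exists 1; split => // x x1 u /= ->; exact: ltW.
  apply: (@closed_comp _ _ (fun u : 'rV[R]_n.+1 => `|u|) [set 1]) => //.
    by move=> u _; exact: norm_continuous.
have S0 : S !=set0.
  have d0 : delta_mx ord0 ord0 != 0 :> 'rV[R]_n.+1.
    by apply/eqP => /matrixP/(_ ord0 ord0); rewrite !mxE !eqxx => /eqP; rewrite oner_eq0.
  exists (`|delta_mx ord0 ord0 : 'rV[R]_n.+1|^-1 *: delta_mx ord0 ord0).
  by rewrite /S/= normrZ ger0_norm ?invr_ge0// mulVf// normr_eq0.
have [c /set_mem Sc cmin] := compact_EVT_min S0 cS (continuous_subspaceT cN).
have c0 : 0 < N c.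
  rewrite lt_neqAle N_ge0 andbT eq_sym; apply/eqP => /N0 ce.
  by move: Sc; rewrite /S/= ce normr0 => /esym/eqP; rewrite oner_eq0.
exists (N c) => // u i; apply: (@le_trans _ _ (N c * `|u|)).
  rewrite ler_wpM2l//.
  exact: coord_le_norm.
have [->|u0] := eqVneq u 0; first by rewrite normr0 mulr0 N00.
rewrite -ler_pdivlMr ?normr_gt0// mulrC -[X in X * _]ger0_norm ?invr_ge0// -NZ.
apply: cmin; apply/mem_set; rewrite /S/= normrZ ger0_norm ?invr_ge0//.
by rewrite mulVf// normr_eq0.
Qed.

End norm_equivalence.

Section hahn_banach.
Context {R : realType} {B : normedModType R}.
Variable K : R.
Hypothesis K0 : 0 <= K.

(** Functionals on subspaces are handled as graphs, so that extension is inclusion. Both clauses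
    together imply single-valuedness: if $(0, a)$ and $(0, -a)$ lie in [G], then $a = 0$. *)
Let dominated (G : set (B * R)) :=
  [/\ (forall c x y a b, G (x, a) -> G (y, b) -> G (c *: x + y, c * a + b)) &
      forall x a, G (x, a) -> a <= K * `|x|].

(** The value at [x0] has to lie between all $a - K|x - x_0|$ and all $K|y + x_0| - b$; the triangle
    inequality makes these bounds compatible, and the supremum of the lower ones is taken. *)
Let dominated_add G x0 : dominated G -> G !=set0 -> exists alpha : R,
  dominated [set p | exists x a c, G (x, a) /\ p = (x + c *: x0, a + c * alpha)].
Proof.
move=> [Glin Gdom] [[x1 a1] G1].
have key x a y b : G (x, a) -> G (y, b) -> a - K * `|x - x0| <= K * `|y + x0| - b.
  move=> Gx Gy; rewrite lerBrDr addrAC lerBlDr -mulrDr.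
  have := Gdom _ _ (Glin 1 _ _ _ _ Gx Gy); rewrite scale1r mul1r => /le_trans; apply.
  rewrite ler_wpM2l//; have -> : x + y = (x - x0) + (y + x0).
    by rewrite addrACA addNr addr0.
  by rewrite (le_trans (ler_normD _ _))// addrC.
pose S := [set s | exists x a, G (x, a) /\ s = a - K * `|x - x0|].
have S0 : S !=set0 by exists (a1 - K * `|x1 - x0|), x1, a1.
have ubS y b : G (y, b) -> ubound S (K * `|y + x0| - b).
  by move=> Gy _ [x [a [Gx ->]]]; exact: key.
have hS : has_sup S by split => //; exists (K * `|x1 + x0| - a1); exact: ubS.
exists (sup S); split.
  move=> c _ _ _ _ [x [a [e [Gx [-> ->]]]]] [y [b [f [Gy [-> ->]]]]].
  exists (c *: x + y), (c * a + b), (c * e + f); split; first exact: Glin.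
  congr pair; last by rewrite !mulrDr mulrDl mulrA addrACA.
  by rewrite scalerDr scalerDl scalerA addrACA.
have G0 : G (0, 0) by have := Glin (-1) _ _ _ _ G1 G1; rewrite scaleN1r mulN1r !addNr.
have GZ c x a : G (x, a) -> G (c *: x, c * a).
  by move=> Gx; have := Glin c _ _ _ _ Gx G0; rewrite !addr0.
move=> _ _ [x [a [c [Gx [-> ->]]]]].
have [c0|c0|->] := ltgtP c 0; last by rewrite mul0r scale0r !addr0; exact: Gdom.
- have Nc : 0 < - c by rewrite oppr_gt0.
  have : (- c)^-1 * a - K * `|(- c)^-1 *: x - x0| <= sup S.
    by apply: sup_upper_bound => //; exists ((- c)^-1 *: x), ((- c)^-1 * a); split; first exact: GZ.
  rewrite lerBlDr => H.
  have -> : x + c *: x0 = (- c) *: ((- c)^-1 *: x - x0).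
    by rewrite scalerBr scalerA mulfV ?gt_eqF// scale1r scaleNr opprK.
  rewrite normrZ gtr0_norm// mulrCA.
  have -> : a + c * sup S = (- c) * ((- c)^-1 * a - sup S).
    by rewrite mulrBr mulrA mulfV ?gt_eqF// mul1r mulNr opprK.
  by rewrite ler_pM2l// lerBlDl.
- have : sup S <= K * `|c^-1 *: x + x0| - c^-1 * a.
    by apply: ge_sup => //; apply: ubS; exact: GZ.
  rewrite lerBrDr => H.
  have -> : x + c *: x0 = c *: (c^-1 *: x + x0).
    by rewrite scalerDr scalerA mulfV ?gt_eqF// scale1r.
  rewrite normrZ gtr0_norm// mulrCA.
  have -> : a + c * sup S = c * (sup S + c^-1 * a).
    by rewrite mulrDr mulrA mulfV ?gt_eqF// mul1r addrC.
  by rewrite ler_pM2l.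
Qed.

Lemma hahn_banach (V : set B) (f : B -> R) :
  V !=set0 ->
  (forall c u v, V u -> V v -> V (c *: u + v)) ->
  (forall c u v, V u -> V v -> f (c *: u + v) = c * f u + f v) ->
  (forall v, V v -> f v <= K * `|v|) ->
  exists g : B -> R^o, [/\ linear g, forall v, V v -> g v = f v &
    forall x, `|g x| <= K * `|x|].
Proof.
move=> [v0 Vv0] Vlin flin fdom.
pose G0 := [set p : B * R | V p.1 /\ p.2 = f p.1].
have domG0 : dominated G0.
  split=> [c x y a b [/= Vx ->] [/= Vy ->]|x a [/= Vx ->]]; last exact: fdom.
  by split=> /=; [exact: Vlin|rewrite flin].
(* Zorn's lemma runs over the sets whose union with [G0] is dominated, so that the empty chain has a
   bound as well. *)
have [|A [domA maxA]] := @Zorn_bigcup _ (fun G => dominated (G `|` G0)).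
  move=> F FP Ftot; split.
    move=> c x y a b [[X FX Xx]|G0x] [[Y FY Yy]|G0y].
    - have [XY|YX] := Ftot _ _ FX FY.
        have [H|H] := (FP _ FY).1 c x y a b (or_introl (XY _ Xx)) (or_introl Yy); [left; exists Y|right] => //.
      have [H|H] := (FP _ FX).1 c x y a b (or_introl Xx) (or_introl (YX _ Yy)); [left; exists X|right] => //.
    - have [H|H] := (FP _ FX).1 c x y a b (or_introl Xx) (or_intror G0y); [left; exists X|right] => //.
    - have [H|H] := (FP _ FY).1 c x y a b (or_intror G0x) (or_introl Yy); [left; exists Y|right] => //.
    - by right; exact: domG0.1.
  move=> x a [[X FX Xx]|G0x]; last exact: domG0.2.
  by apply: (FP _ FX).2; left.
pose M := A `|` G0.
have M0 : M !=set0 by exists (v0, f v0); right.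
(* A point outside the domain would yield a strictly larger dominated graph by [dominated_add]. *)
have total x : exists a, M (x, a).
  apply: contrapT => /forallNP nM.
  have [al domM'] := dominated_add x domA M0.
  set M' := (X in dominated X) in domM'.
  have MM' : M `<=` M'.
    by move=> [y b] My; exists y, b, 0; rewrite scale0r mul0r !addr0.
  have [[y b] My] := M0; apply: (maxA M'); last first.
    rewrite (_ : M' `|` G0 = M')//; apply/setUidPl; apply: subset_trans MM'.
    exact: subsetUr.
  split; first by apply: subset_trans MM'; exact: subsetUl.
  move=> M'A; apply: (nM al); left; apply: M'A.
  exists 0, 0, 1; rewrite scale1r mul1r !add0r; split=> //.
  have := domA.1 (-1) _ _ _ _ My My.
  by rewrite scaleN1r mulN1r !addNr.
have [g gM] := choice total.
have Muniq x a b : M (x, a) -> M (x, b) -> a = b.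
  move=> Ma Mb; apply/eqP; rewrite eq_le; apply/andP; split; rewrite -subr_le0.
    have := domA.2 _ _ (domA.1 (-1) _ _ _ _ Mb Ma).
    by rewrite scaleN1r mulN1r addNr normr0 mulr0 addrC.
  have := domA.2 _ _ (domA.1 (-1) _ _ _ _ Ma Mb).
  by rewrite scaleN1r mulN1r addNr normr0 mulr0 addrC.
have glin : linear (g : B -> R^o).
  by move=> c x y; exact: (Muniq _ _ _ (gM _) (domA.1 c _ _ _ _ (gM x) (gM y))).
exists g; split => //.
  by move=> v Vv; apply: (Muniq v) => //; right.
move=> x; rewrite ler_norml (domA.2 _ _ (gM x)) andbT lerNl -[`|x|]normrN.
apply: (domA.2 (- x)); have := domA.1 (-1) _ _ _ _ (gM x) (gM 0).
suff -> : g 0 = 0 by rewrite !addr0 scaleN1r mulN1r.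
by have := glin (-1) 0 0; rewrite scaler0 addr0 scaleN1r addNr.
Qed.

End hahn_banach.

(** * Almost Auerbach bases *)

Section norming.
Context {R : realType} {B : normedModType R}.

Lemma lin_comb_lin (E : lmodType R) n (b : 'I_n -> E) c (u v : 'I_n -> R) :
  lin_comb b (fun j => c * u j + v j) = c *: lin_comb b u + lin_comb b v.
Proof.
rewrite /lin_comb scaler_sumr -big_split/=; apply: eq_bigr => j _.
by rewrite scalerDl scalerA.
Qed.

Lemma lin_comb0 (E : lmodType R) n (b : 'I_n -> E) : lin_comb b (fun=> 0) = 0.
Proof. by rewrite /lin_comb big1// => j _; rewrite scale0r. Qed.

Lemma lin_comb_rowD (E : lmodType R) n (b : 'I_n -> E) (u v : 'rV[R]_n) :
  lin_comb b ((u + v) ord0) = lin_comb b (u ord0) + lin_comb b (v ord0).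
Proof.
rewrite -[X in _ = X + _]scale1r -lin_comb_lin; congr lin_comb.
by apply/funext => j; rewrite mxE mul1r.
Qed.

Lemma lin_comb_rowZ (E : lmodType R) n (b : 'I_n -> E) c (u : 'rV[R]_n) :
  lin_comb b ((c *: u) ord0) = c *: lin_comb b (u ord0).
Proof.
rewrite /lin_comb scaler_sumr; apply: eq_bigr => j _.
by rewrite mxE scalerA.
Qed.

Lemma lin_comb_delta (E : lmodType R) n (b : 'I_n -> E) i :
  lin_comb b (fun j => (i == j)%:R) = b i.
Proof.
rewrite /lin_comb (bigD1 i)//= eqxx scale1r big1 ?addr0// => j ji.
by rewrite eq_sym (negbTE ji) scale0r.
Qed.

(** Leibniz expansion; a crude bound suffices to make a set of determinants bounded. *)
Lemma det_norm_le n (A : 'M[R]_n) c : (forall i j, `|A i j| <= c) ->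
  `|\det A| <= (#|'S_n|)%:R * c ^+ n.
Proof.
move=> Ac; rewrite /determinant; apply: le_trans (ler_norm_sum _ _ _) _.
rewrite -sum1_card natr_sum mulr_suml; apply: ler_sum => s _.
rewrite normrM normrX normrN1 expr1n !mul1r normr_prod.
rewrite -[n in leRHS]card_ord -prodr_const.
by apply: ler_prod => i _; rewrite normr_ge0/=.
Qed.

(* Auerbach's argument with an almost maximal determinant: attaining the
   supremum would only improve the factor 2. *)
Lemma almost_auerbach n (b : 'I_n -> B) : injective (lin_comb b) ->
  exists A : 'M[R]_n, [/\ \det A != 0,
    forall l, `|lin_comb b (A l)| <= 1 &
    forall (u : 'rV[R]_n) l,
      `|(u *m \adj A) ord0 l| <= 2 * `|\det A| * `|lin_comb b (u ord0)|].
Proof.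
move=> injb; pose N (u : 'rV[R]_n) := `|lin_comb b (u ord0)|.
have [m m0 mN] : exists2 m, 0 < m & forall (u : 'rV[R]_n) i, m * `|u ord0 i| <= N u.
  apply: norm_coord_le => [u v|a u|u].
  - by rewrite /N lin_comb_rowD ler_normD.
  - by rewrite /N lin_comb_rowZ normrZ.
  - move=> /normr0_eq0; rewrite -(lin_comb0 b) => /injb u0.
    by apply/rowP => j; rewrite u0 mxE.
(* Determinants of the coordinate matrices of [n] vectors of the unit ball; bounded, since by [mN]
   these coordinates are at most [m^-1]. *)
pose S := [set x | exists A : 'M[R]_n, (forall l, `|lin_comb b (A l)| <= 1) /\ x = `|\det A|].
have ubS : ubound S ((#|'S_n|)%:R * m^-1 ^+ n).
  move=> _ [A [A1 ->]]; apply: det_norm_le => i j.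
  rewrite -[leRHS]mulr1 ler_pdivlMl//; apply: le_trans (A1 i).
  have := mN (row i A) j; rewrite /N mxE => /le_trans; apply.
  by rewrite le_eqVlt; apply/orP; left; apply/eqP; congr (`| lin_comb b _ |); apply/funext => k; rewrite mxE.
(* All [c *: b l] lie in the unit ball, so the supremum is positive. *)
pose c := (1 + \sum_l `|b l|)^-1.
have c0 : 0 < c by rewrite invr_gt0 ltr_pwDl// sumr_ge0.
have Sc : S (c ^+ n).
  exists (c%:M); split; last by rewrite det_scalar ger0_norm// exprn_ge0// ltW.
  move=> l; rewrite (_ : lin_comb b _ = c *: b l); last first.
    rewrite /lin_comb (bigD1 l)//= mxE eqxx mulr1n big1 ?addr0// => j jl.
    by rewrite mxE eq_sym (negbTE jl) mulr0n scale0r.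
  rewrite normrZ gtr0_norm// mulrC ler_pdivrMr ?mul1r; last by rewrite ltr_pwDl// sumr_ge0.
  by rewrite (bigD1 l)//= addrCA lerDl addr_ge0// sumr_ge0.
have hS : has_sup S by split; [exists (c ^+ n)|exists ((#|'S_n|)%:R * m^-1 ^+ n)].
have supS : 0 < sup S.
  by apply: lt_le_trans (_ : c ^+ n <= _); [rewrite exprn_gt0|exact: sup_upper_bound].
have [|_ [A [A1 ->]] Ad] := @sup_adherent _ S (sup S / 2) _ hS; first by rewrite divr_gt0.
have dA : 0 < `|\det A| by apply: le_lt_trans Ad; rewrite subr_ge0 ler_pdivrMr// ler_peMr// ?ler1n// ltW.
(* By Laplace expansion this entry is the determinant of [A] with row [l] replaced by [u], hence at
   most [sup S], which is below $2|\det A|$. *)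
have small (u : 'rV[R]_n) l : N u <= 1 -> `|(u *m \adj A) ord0 l| <= 2 * `|\det A|.
  move=> Nu.
  pose A' : 'M[R]_n := \matrix_(i, j) if i == l then u ord0 j else A i j.
  have -> : (u *m \adj A) ord0 l = \det A'.
    rewrite (expand_det_row A' l) mxE; apply: eq_bigr => j _; rewrite !mxE eqxx.
    congr (_ * _); rewrite /cofactor; congr (_ * \det _); apply/matrixP => p q.
    by rewrite !mxE eq_sym (negbTE (neq_lift _ _)).
  have : `|\det A'| <= sup S.
    apply: sup_upper_bound => //; exists A'; split=> // i.
    have [->|il] := eqVneq i l.
      rewrite (_ : A' l = u ord0)//; apply/funext => j; by rewrite mxE eqxx.
    by rewrite (_ : A' i = A i)//; apply/funext => j; rewrite mxE (negbTE il).
  move=> /le_trans; apply; move: Ad; lra.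
exists A; split => //; first by rewrite -normr_gt0.
move=> u l; have [u0|u0] := eqVneq u 0.
  by rewrite u0 mul0mx mxE normr0 mulr_ge0// mulr_ge0.
have Nu : 0 < N u.
  have [i ui] : exists i, u ord0 i != 0.
    apply/existsP; apply: contraNT u0 => /existsPn H; apply/eqP/rowP => i.
    by rewrite mxE; apply/eqP; rewrite -[_ == _]negbK H.
  by apply: lt_le_trans (mN u i); rewrite mulr_gt0// normr_gt0.
have := small ((N u)^-1 *: u) l; rewrite {1}/N lin_comb_rowZ normrZ.
rewrite gtr0_norm ?invr_gt0// mulVf ?gt_eqF// => /(_ (lexx _)).
by rewrite -scalemxAl mxE normrM gtr0_norm ?invr_gt0// ler_pdivrMl// mulrC.
Qed.

(** The coordinates of a vector $v$ in the almost Auerbach basis [e] are the entries of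
    $u\,\mathrm{adj}(A)$ divided by $\det A$, of size at most $2|v|$; halving them gives norm at
    most 1. The last bound expands $v$ as $\sum_l 2\psi_l(v)\,e_l$ with $|e_l| \le 1$. *)
Lemma norming_functionals n (b : 'I_n -> B) : injective (lin_comb b) ->
  exists (psi : 'I_n -> B -> R^o) (e : 'I_n -> B),
    [/\ forall l, linear (psi l), forall l x, `|psi l x| <= `|x|,
        forall l m, psi l (e m) = (l == m)%:R / 2 &
        forall a, `|lin_comb b a| <= 2 * \sum_l `|psi l (lin_comb b a)| ].
Proof.
move=> injb; have [A [dA A1 Aadj]] := almost_auerbach injb.
(* Coordinates in [b], meaningful on the span of [b] only. *)
have [co coK] : exists co : B -> 'rV[R]_n, forall a, co (lin_comb b a) = \row_j a j.
  exists (fun v => \row_j xget (fun=> 0) [set a | lin_comb b a = v] j) => a.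
  apply/rowP => j; rewrite !mxE; case: xgetP => [a' _ /= /injb ->//|].
  by move=> /(_ a) [].
pose V := range (lin_comb b).
pose f l v := (co v *m \adj A) ord0 l / (2 * \det A).
have coD c u v : V u -> V v -> co (c *: u + v) = c *: co u + co v.
  move=> [a _ <-] [a' _ <-]; rewrite -lin_comb_lin !coK.
  by apply/rowP => j; rewrite !mxE.
have fdom l v : V v -> f l v <= 1 * `|v|.
  move=> [a _ <-]; rewrite /f coK mul1r; apply: le_trans (ler_norm _) _.
  rewrite normf_div (_ : `|2 * \det A| = 2 * `|\det A|); last by rewrite normrM ger0_norm.
  rewrite ler_pdivrMr ?mulr_gt0 ?normr_gt0// mulrC.
  rewrite (_ : lin_comb b a = lin_comb b ((\row_j a j) ord0)); first exact: Aadj.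
  by congr lin_comb; apply/funext => j; rewrite mxE.
have ext l : exists g : B -> R^o, [/\ linear g, forall v, V v -> g v = f l v &
    forall x, `|g x| <= 1 * `|x|].
  apply: hahn_banach => //.
  - by exists 0; exists (fun=> 0) => //; exact: lin_comb0.
  - move=> c _ _ [a _ <-] [a' _ <-]; exists (fun j => c * a j + a' j) => //.
    exact: lin_comb_lin.
  - move=> c u v Vu Vv; rewrite /f coD// mulmxDl -scalemxAl !mxE.
    by rewrite mulrDl mulrA.
  - exact: fdom.
have [psi psiP] := choice ext.
have psiV l v : V v -> psi l v = f l v by have [_ H _] := psiP l; exact: H.
have coA l : co (lin_comb b (A l)) = row l A.
  by rewrite coK; apply/rowP => j; rewrite !mxE.
exists psi, (fun l => lin_comb b (A l)); split.
- by move=> l; have [] := psiP l.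
- by move=> l x; have [_ _ /(_ x)] := psiP l; rewrite mul1r.
- move=> l m; rewrite psiV; last by exists (A m).
  rewrite /f coA -row_mul mul_mx_adj !mxE eq_sym.
  case: eqVneq => _; last by rewrite mulr0n !mul0r.
  by rewrite mulr1n mul1r invfM mulrCA mulfV// mulr1.
- move=> a; pose u := \row_j a j.
  have aE : lin_comb b a = \sum_l (2 * psi l (lin_comb b a)) *: lin_comb b (A l).
    under eq_bigr => l _.
      rewrite psiV; last by exists a.
      rewrite /f coK.
      over.
    have uE : u = \sum_l (2 * ((u *m \adj A) ord0 l / (2 * \det A))) *: row l A.
      have : u = (\det A)^-1 *: (u *m \adj A *m A).
        by rewrite -mulmxA mul_adj_mx mul_mx_scalar scalerA mulVf// scale1r.
      rewrite [in X in _ = _ *: X -> _]mulmx_sum_row scaler_sumr => {1}->.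
      apply: eq_bigr => l _; rewrite scalerA; congr (_ *: _).
      by rewrite invfM; field.
    transitivity (lin_comb b (u ord0)); first by congr lin_comb; apply/funext => j; rewrite mxE.
    rewrite [in LHS]uE.
    elim/big_ind2 : _ => [||l _].
    - by rewrite -[RHS](lin_comb0 b); congr lin_comb; apply/funext => j; rewrite mxE.
    - by move=> x1 x2 y1 y2 <- <-; rewrite lin_comb_rowD.
    - rewrite lin_comb_rowZ; congr (_ *: lin_comb b _).
      by apply/funext => j; rewrite mxE.
  rewrite [in leLHS]aE.
  apply: le_trans (ler_norm_sum _ _ _) _; rewrite mulr_sumr; apply: ler_sum => l _.
  by rewrite normrZ normrM ger0_norm// ler_piMr// mulr_ge0.
Qed.

End norming.

(** * Slabs of convex bodies *)

Section tuple_open.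
Context {R : realType}.
Local Notation RT n := (n.-tuple (measurableTypeR R)).

Definition tuple_box n (q : RT n) (r : R) : set (RT n) :=
  [set a | forall i, `|tnth a i - tnth q i| < r].

Lemma measurable_tuple_box n (q : RT n) r : measurable (tuple_box q r).
Proof.
rewrite (_ : tuple_box q r = \bigcap_(i in [set: 'I_n])
   ((fun a : RT n => tnth a i) @^-1` [set x | `|x - tnth q i| < r])).
  apply: fin_bigcap_measurable; first exact: finite_finset.
  move=> i _; rewrite -[X in measurable X]setTI; apply: measurable_tnth => //.
  rewrite (_ : [set x | _] = `]tnth q i - r, tnth q i + r[%classic); first exact: measurable_itv.
  by apply/seteqP; split=> x /=; rewrite in_itv/= ltr_distl.
by apply/seteqP; split=> a /= => [H i _|H i]; [exact: H|exact: (H i Logic.I)].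
Qed.

(** An open set is a countable union of rational boxes. The dual unit ball is cut out by one
    condition per point of a space that need not be separable, so its measurability is obtained from
    openness of the complement and not from a countable intersection. *)
Lemma measurable_tuple_open n (A : set (RT n)) :
  (forall a, A a -> exists2 r, 0 < r & tuple_box a r `<=` A) -> measurable A.
Proof.
move=> oA.
pose D := [set p : n.-tuple rat * rat |
  tuple_box [tuple of map ratr p.1] (ratr p.2) `<=` A].
pose F (p : n.-tuple rat * rat) : set (RT n) :=
  if p \in D then tuple_box [tuple of map ratr p.1] (ratr p.2) else set0.
have -> : A = \bigcup_p F p.
  apply/seteqP; split=> [a Aa|a [p _]]; last first.
    by rewrite /F; case: ifPn => // /set_mem pD /pD.
  have [r r0 aA] := oA _ Aa.
  have r2 : 0 < r / 2 by rewrite divr_gt0.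
  have [s] := rat_in_itvoo r2.
  rewrite in_itv/= => /andP[s0 sr].
  have H i : exists q : rat, `|tnth a i - ratr q| < ratr s.
    have : tnth a i - ratr s < tnth a i + ratr s by lra.
    move=> /rat_in_itvoo[q].
    by rewrite in_itv/= => /andP[q1 q2]; exists q; rewrite distrC ltr_distl q1.
  have [q qP] := choice H.
  have E (x : n.-tuple rat) i : tnth ([tuple of map ratr x] : RT n) i = ratr (tnth x i).
    by rewrite tnth_map.
  exists ([tuple q i | i < n], s) => //; rewrite /F mem_set; last first.
    move=> b bq; apply: aA => i; have := bq i; have := qP i.
    rewrite E tnth_mktuple; move: sr => /= sr qa bqi.
    rewrite -(subrK (ratr (q i)) (tnth b i)) -addrA (le_lt_trans (ler_normD _ _))//.
    by rewrite [X in _ + X]distrC; move: sr qa bqi; rewrite /=; lra.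
  by move=> i; rewrite E tnth_mktuple.
apply: countable_bigcupT_measurable => //.
by move=> p; rewrite /F; case: ifP => // _; exact: measurable_tuple_box.
Qed.

End tuple_open.

Section slab.
Context {R : realType} (n : nat).
Local Notation RT := (n.-tuple (measurableTypeR R)).

Definition dual_pairing (c : 'I_n -> R) (a : RT) : R := \sum_i tnth a i * c i.

Lemma measurable_dual_pairing c : measurable_fun setT (dual_pairing c).
Proof.
apply: measurable_sum => i; apply: measurable_funM; last exact: measurable_cst.
exact: measurable_tnth.
Qed.

Definition tuple_opp (p : RT) : RT := [tuple - tnth p i | i < n].

Definition towards (l : R) (p a : RT) : RT := [tuple (1 - l) * tnth a i + l * tnth p i | i < n].

Lemma dual_pairing_towards c l p a :
  dual_pairing c (towards l p a) = (1 - l) * dual_pairing c a + l * dual_pairing c p.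
Proof.
rewrite /dual_pairing !mulr_sumr -big_split/=; apply: eq_bigr => i _.
by rewrite tnth_mktuple mulrDl !mulrA.
Qed.

Lemma dual_pairing_opp c p : dual_pairing c (tuple_opp p) = - dual_pairing c p.
Proof.
by rewrite /dual_pairing -sumrN; apply: eq_bigr => i _; rewrite tnth_mktuple mulNr.
Qed.

(** The contracted copy of [S] is written as a preimage under the inverse affine map, which gives
    its measurability at once. *)
Lemma lebesgue_tuple_towards l p (S : set RT) : l < 1 -> measurable S ->
  exists F : set RT, [/\ measurable F,
    lebesgue_tuple n F = (((1 - l) ^+ n)%:E * lebesgue_tuple n S)%E &
    forall y, F y -> exists2 a, S a & y = towards l p a].
Proof.
move=> l1 mS; have l1' : 0 < 1 - l by rewrite subr_gt0.
pose v : RT := [tuple - (l / (1 - l)) * tnth p i | i < n].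
exists (affine_tuple (1 - l)^-1 v @^-1` S); split.
- by rewrite -[X in measurable X]setTI; exact: measurable_affine_tuple.
- by rewrite lebesgue_tuple_affine ?invr_gt0// invrK.
- move=> y Sy; exists (affine_tuple (1 - l)^-1 v y) => //.
  apply: eq_from_tnth => i; rewrite !tnth_mktuple; field.
  by rewrite gt_eqF.
Qed.

Lemma bernoulli_half (l : R) : (0 < n)%N -> 0 <= l -> l <= (2 * n%:R)^-1 -> 2^-1 <= (1 - l) ^+ n.
Proof.
move=> n0 l0 ln.
have n1 : 1 <= n%:R :> R by rewrite ler1n.
have nl : n%:R * l <= 2^-1.
  by rewrite mulrC -ler_pdivlMr ?ltr0n// -invfM.
have l1 : l <= 1 by nra.
have : 1 - n%:R * l <= (1 - l) ^+ n.
  elim: n => [|m IH]; first by rewrite mul0r subr0 expr0.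
  rewrite exprS -natr1.
  apply: le_trans (_ : (1 - l) * (1 - m%:R * l) <= _); last by rewrite ler_wpM2l// subr_ge0.
  have m0 : 0 <= m%:R :> R by rewrite ler0n.
  nra.
lra.
Qed.

Variable U : set RT.
Hypothesis mU : measurable U.
Variables (c : 'I_n -> R) (p : RT) (g : R).
Hypothesis g0 : 0 < g.
Hypothesis pg : g <= `|dual_pairing c p|.
Hypothesis convU : forall l a, 0 <= l <= 1 -> U a ->
  U (towards l p a) /\ U (towards l (tuple_opp p) a).

(* Moving a slab of [U] towards [p] or [- p] by a factor at most [1 / 2n]
   costs at most half of its volume, and [g / 6ns] of the moved slabs are
   disjoint; no Brunn-Minkowski inequality is needed. *)
Lemma slab_volume (x s : R) : 0 < s ->
  (lebesgue_tuple n (U `&` [set a | (`|dual_pairing c a - x| <= s)%R])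
   <= (12 * n%:R * s / g)%:E * lebesgue_tuple n U)%E.
Proof.
move=> s0; set S := U `&` _.
have n0 : (0 < n)%N.
  rewrite lt0n; apply/eqP => n0; move: pg; rewrite /dual_pairing.
  move: g0 => /[swap]; rewrite big1 ?normr0 ?leNgt; first by move=> /negP.
  by move=> i _; exfalso; have := ltn_ord i; rewrite {2}n0 ltn0.
have nr0 : 0 < n%:R :> R by rewrite ltr0n.
have mS : measurable S.
  apply: measurableI => //.
  rewrite (_ : [set a | _] = dual_pairing c @^-1` `[x - s, x + s]%classic).
    by rewrite -[X in measurable X]setTI; apply: measurable_dual_pairing.
  by apply/seteqP; split=> a /=; rewrite in_itv/= ler_distl.
(* Of [p] and its opposite, one has a pairing of sign opposite to [x], hence at distance at least
   [g] from [x]; contracting towards it really displaces the slab. *)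
have [q [qU qx qg]] : exists q : RT, [/\ (forall l a, 0 <= l <= 1 -> U a -> U (towards l q a)),
    dual_pairing c q * x <= 0 & g <= `|dual_pairing c q|].
  have [px|px] := leP (dual_pairing c p * x) 0.
    by exists p; split=> // l a l1 Ua; exact: (convU l1 Ua).1.
  exists (tuple_opp p); split.
  - by move=> l a l1 Ua; exact: (convU l1 Ua).2.
  - by rewrite dual_pairing_opp mulNr oppr_le0 ltW.
  - by rewrite dual_pairing_opp normrN.
(* More than $g/(6ns)$ contractions are used, and the strongest one still has ratio at most
   $1/(2n)$. *)
pose J := (Num.truncn (g / (6 * n%:R * s))).+1.
have /andP[J1 J2] : (J.-1)%:R <= g / (6 * n%:R * s) < J%:R.
  by apply: truncn_itv; rewrite divr_ge0 ?ltW// !mulr_gt0.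
(* Consecutive ratios differ by $3s/g$, which displaces the slab by at least $3s$, beyond its width
   $2s$. *)
pose lam (h : nat) : R := 3 * h%:R * s / g.
have lam0 h : 0 <= lam h by rewrite divr_ge0 ?mulr_ge0// ?ltW.
have lamJ h : (h < J)%N -> lam h <= (2 * n%:R)^-1.
  move=> hJ; apply: (@le_trans _ _ (lam J.-1)).
    by rewrite /lam ler_pM2r ?invr_gt0// ler_pM2r// ler_pM2l// ler_nat -ltnS.
  rewrite /lam ler_pdivrMr// ler_pdivlMl ?mulr_gt0//.
  by move: J1; rewrite ler_pdivlMr ?mulr_gt0//; lra.
have lam1 h : (h < J)%N -> lam h < 1.
  move=> /lamJ/le_lt_trans; apply; rewrite invf_lt1 ?mulr_gt0//.
  by have : 1 <= n%:R :> R by [rewrite ler1n]; lra.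
have HF h : exists F : set RT, (h < J)%N -> [/\ measurable F,
    lebesgue_tuple n F = (((1 - lam h) ^+ n)%:E * lebesgue_tuple n S)%E &
    forall y, F y -> exists2 a, S a & y = towards (lam h) q a].
  have [hJ|hJ] := ltnP h J; last by exists set0.
  by have [F FP] := lebesgue_tuple_towards q (lam1 _ hJ) mS; exists F.
have [F FP] := choice HF.
have FU (h : 'I_J) : F h `<=` U.
  move=> y Fy; have [_ _ /(_ y Fy)[a Sa ->]] := FP h (ltn_ord h).
  by apply: qU; [rewrite lam0 ltW// lam1|exact: Sa.1].
have tF : trivIset setT (fun h : 'I_J => F h).
  apply/trivIsetP => /= i j _ _ ij; rewrite -subset0 => y [Fi Fj].
  have [_ _ /(_ y Fi)[a [_ Sa] ya]] := FP i (ltn_ord i).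
  have [_ _ /(_ y Fj)[b [_ Sb] yb]] := FP j (ltn_ord j).
  have : dual_pairing c (towards (lam i) q a) = dual_pairing c (towards (lam j) q b) by rewrite -ya yb.
  rewrite !dual_pairing_towards; move: Sa Sb => /=.
  have li := lam1 i (ltn_ord i); have lj := lam1 j (ltn_ord j).
  have li0 := lam0 i; have lj0 := lam0 j.
  have : 3 * s <= `|lam i - lam j| * g.
    have -> : `|lam i - lam j| * g = 3 * s * `|i%:R - j%:R|.
      rewrite -[X in _ * X](gtr0_norm g0) -normrM.
      have -> : (lam i - lam j) * g = 3 * s * (i%:R - j%:R).
        by rewrite /lam; field; rewrite gt_eqF.
      by rewrite normrM gtr0_norm// mulr_gt0.
    rewrite ler_peMr ?mulr_ge0 ?(ltW s0)//.
    have [lt|lt|e] := ltngtP (i : nat) j; last by move: ij; rewrite (ord_inj e) eqxx.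
      by rewrite distrC -natrB 1?ltnW// normr_nat ler1n subn_gt0.
    by rewrite -natrB 1?ltnW// normr_nat ler1n subn_gt0.
  set A := dual_pairing c a; set A' := dual_pairing c b.
  set Q := dual_pairing c q in qx qg *.
  set l := lam i in li li0 *; set l' := lam j in lj lj0 *.
  move=> lg; rewrite !ler_norml => /andP[a1 a2] /andP[b1 b2] E.
  have Qx : `|l - l'| * g <= `|(l - l') * (Q - x)|.
    rewrite normrM ler_wpM2l//; apply: le_trans qg _.
    by rewrite -ler_sqr ?nnegrE// !real_normK ?num_real//; nra.
  (* A common point of two moved slabs gives this identity, whose left side is at least $3s$ in
     absolute value and whose right side is at most $2s$. *)
  have : (l - l') * (Q - x) = (1 - l') * (A' - x) - (1 - l) * (A - x) by move: E; lra.
  move=> e; move: Qx; rewrite e => Qx.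
  have : `|(1 - l') * (A' - x) - (1 - l) * (A - x)| <= 2 * s.
    rewrite ler_norml; apply/andP; split; nra.
  by move=> h; have := le_trans (le_trans lg Qx) h; lra.
have sumF : ((J%:R / 2)%:E * lebesgue_tuple n S <= lebesgue_tuple n U)%E.
  apply: (@le_trans _ _ (\sum_(h < J) lebesgue_tuple n (F h))%E); last first.
    rewrite -measure_bigsetU_ord//; last by move=> h; have [] := FP h (ltn_ord h).
    apply: le_measure; rewrite ?inE//.
      by apply: bigsetU_measurable => h _; have [] := FP h (ltn_ord h).
    by rewrite -bigcup_seq => y [h _ Fy]; exact: (FU h).
  apply: (@le_trans _ _ (\sum_(h < J) (2^-1)%:E * lebesgue_tuple n S)%E).
    rewrite -ge0_sume_distrl; last by move=> h _; rewrite lee_fin invr_ge0.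
    by rewrite sumEFin sumr_const card_ord -[2^-1 *+ _]mulr_natl.
  apply: lee_sum => h _; have [_ -> _] := FP h (ltn_ord h).
  by rewrite lee_wpmul2r// lee_fin bernoulli_half// lamJ.
have J0 : 0 < J%:R :> R by rewrite ltr0n.
have -> : lebesgue_tuple n S = ((2 / J%:R)%:E * ((J%:R / 2)%:E * lebesgue_tuple n S))%E.
  by rewrite muleA -EFinM (_ : 2 / J%:R * (J%:R / 2) = 1) ?mul1e//; field; rewrite gt_eqF.
apply: (@le_trans _ _ ((2 / J%:R)%:E * lebesgue_tuple n U)%E).
  by rewrite lee_wpmul2l// lee_fin divr_ge0// ltW.
rewrite lee_wpmul2r// lee_fin ler_pdivrMr//.
move: J2; rewrite ltr_pdivrMr ?mulr_gt0// => J2.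
by rewrite mulrAC ler_pdivlMr//; lra.
Qed.

End slab.

(** * The uniform law of a dual unit ball *)

Section dual_ball_facts.
Context {R : realType} {B : normedModType R}.

Lemma lin_combE n (b : 'I_n -> B -> R^o) a x :
  lin_comb b a x = \sum_j a j * b j x.
Proof. by rewrite /lin_comb fct_sumE. Qed.

Lemma linear_lin_comb n (b : 'I_n -> B -> R^o) a :
  (forall j, linear (b j)) -> linear (lin_comb b a).
Proof.
move=> lb c x y; rewrite !lin_combE scaler_sumr -big_split/=.
by apply: eq_bigr => j _; rewrite lb mulrDr mulrCA.
Qed.

Lemma linear0_eq (f : B -> R^o) : linear f -> f 0 = 0.
Proof. by move=> lf; have := lf (-1) 0 0; rewrite scaler0 addr0 scaleN1r addNr. Qed.

Lemma linearZ_eq (f : B -> R^o) c x : linear f -> f (c *: x) = c * f x.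
Proof. by move=> lf; have := lf c x 0; rewrite !addr0 (linear0_eq lf) addr0. Qed.

Lemma linearB_eq (f : B -> R^o) x y : linear f -> f (x - y) = f x - f y.
Proof. by move=> lf; rewrite addrC -scaleN1r lf scaleN1r addrC. Qed.

Lemma dual_spaceP (f : B -> R^o) K : linear f -> (forall x, `|f x| <= K * `|x|) ->
  dual_space f.
Proof.
move=> lf fK; split => // x; apply/(@cvgrPdist_lt _ _ _ (nbhs x)) => e e0.
have K1 : 0 < `|K| + 1 by rewrite ltr_wpDl.
apply/nbhs_normP; exists (e / (`|K| + 1)) => /=; first by rewrite divr_gt0.
move=> y /=; rewrite ltr_pdivlMr// => xy; rewrite -(linearB_eq _ _ lf).
apply: le_lt_trans xy; apply: le_trans (fK _) _; rewrite mulrC ler_wpM2l//.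
by rewrite (le_trans (ler_norm _))// lerDl.
Qed.

(** The bound by [K] ensures that the supremum in [dual_norm] is that of a bounded set and not a
    default value. *)
Lemma dual_norm_le1 (f : B -> R^o) K : linear f -> (forall x, `|f x| <= K * `|x|) ->
  dual_norm f <= 1 <-> forall x, `|f x| <= `|x|.
Proof.
move=> lf fK; have f0 := linear0_eq lf; split=> [f1 x|f1]; last first.
  apply: ge_sup; first by exists `|f 0|; exists 0 => //=; rewrite normr0.
  by move=> _ [x /= x1 <-]; exact: le_trans (f1 x) x1.
have [->|x0] := eqVneq x 0; first by rewrite f0 normr0.
have nx0 : 0 < `|x| by rewrite normr_gt0.
have /le_trans/(_ f1) : `|f (`|x|^-1 *: x)| <= dual_norm f.
  apply: sup_upper_bound; last first.
    exists (`|x|^-1 *: x) => //=.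
    by rewrite normrZ ger0_norm ?invr_ge0// mulVf// gt_eqF.
  split; first by exists `|f 0|; exists 0 => //=; rewrite normr0.
  exists `|K| => _ [y /= y1 <-]; apply: le_trans (fK _) _.
  rewrite (@le_trans _ _ (`|K| * `|y|))//; first by rewrite ler_wpM2r// ler_norm.
  by rewrite ler_piMr.
by rewrite (linearZ_eq _ _ lf) normrM gtr0_norm ?invr_gt0// ler_pdivrMl// mulr1.
Qed.

End dual_ball_facts.

Section dual_system.
Context {R : realType} {B : normedModType R}.
Local Notation RT n := (n.-tuple (measurableTypeR R)).

(** Biorthogonal up to the factor 1/2 lost in the almost Auerbach basis; the vectors [e] serve to
    read off coefficients over [psi]. *)
Definition dual_system n (psi : 'I_n -> B -> R^o) (e : 'I_n -> B) :=
  [/\ forall l, linear (psi l), forall l x, `|psi l x| <= `|x| &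
      forall l m, psi l (e m) = (l == m)%:R / 2].

Variables (n : nat) (psi : 'I_n -> B -> R^o) (e : 'I_n -> B).
Hypothesis psie : dual_system psi e.

Lemma lin_comb_le a x : `|lin_comb psi a x| <= (\sum_l `|a l|) * `|x|.
Proof.
rewrite lin_combE (le_trans (ler_norm_sum _ _ _))// mulr_suml.
by apply: ler_sum => l _; rewrite normrM ler_wpM2l//; have [_ ->] := psie.
Qed.

Lemma lin_comb_dual a m : lin_comb psi a (e m) = a m / 2.
Proof.
rewrite lin_combE (bigD1 m)//= big1 ?addr0.
  by have [_ _ ->] := psie; rewrite eqxx mul1r.
by move=> l lm; have [_ _ ->] := psie; rewrite (negbTE lm) mul0r mulr0.
Qed.

Lemma dual_system_inj : injective (lin_comb psi).
Proof.
move=> a a' aa'; apply/funext => m; have := lin_comb_dual a m.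
by rewrite aa' lin_comb_dual => /(mulIf (invr_neq0 _)) ->//; rewrite pnatr_eq0.
Qed.

Lemma dual_subspace_range : dual_subspace (range (lin_comb psi)).
Proof.
split; last by exists n, psi; split => //; exact: dual_system_inj.
move=> _ [a _ <-]; apply: dual_spaceP (lin_comb_le a).
by apply: linear_lin_comb; have [] := psie.
Qed.

Variables (d : nat) (b : 'I_d -> B -> R^o).
Hypothesis bV : is_basis b (range (lin_comb psi)).

Let M_ex : exists M : 'I_d -> 'I_n -> R, forall j, b j = lin_comb psi (M j).
Proof.
suff /choice[M MP] : forall j, exists m, b j = lin_comb psi m by exists M.
move=> j; have : range (lin_comb b) (b j).
  by exists (fun i => (j == i)%:R) => //; exact: lin_comb_delta.
by rewrite -bV.2 => -[a _ <-]; exists a.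
Qed.

(** The coefficient matrix of [b] over [psi] has independent rows. The slab bound, valid for any
    basis [b] of the span, can thus be stated with [n], whose growth is controlled. *)
Lemma basis_size : (d <= n)%N.
Proof.
have [M bM] := M_ex; pose A : 'M[R]_(d, n) := \matrix_(j, l) M j l.
suff : row_free A by rewrite /row_free => /eqP <-; exact: rank_leq_col.
apply: inj_row_free => v vA0; apply/rowP => j; rewrite mxE.
have : lin_comb b (v ord0) = lin_comb b (fun=> 0).
  rewrite lin_comb0; apply/funext => x; rewrite lin_combE.
  under eq_bigr do rewrite bM lin_combE mulr_sumr.
  rewrite exchange_big/= big1// => l _.
  under eq_bigr do rewrite mulrA.
  rewrite -mulr_suml; have /rowP/(_ l) := vA0; rewrite !mxE.
  under eq_bigr do rewrite mxE.
  by move=> ->; rewrite mul0r.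
by move=> /bV.1 ->.
Qed.

Let lb j : linear (b j).
Proof. by have [M ->] := M_ex; apply: linear_lin_comb; have [] := psie. Qed.

Let b_le : exists K : 'I_d -> R, forall j, 0 <= K j /\ forall x, `|b j x| <= K j * `|x|.
Proof.
have [M bM] := M_ex; exists (fun j => \sum_l `|M j l|) => j; split; first exact: sumr_ge0.
by move=> x; rewrite bM; exact: lin_comb_le.
Qed.

Lemma unit_ball_coordE : unit_ball_coord b =
  [set a | forall x, `|lin_comb b (tnth a) x| <= `|x|].
Proof.
have [M bM] := M_ex.
apply/seteqP; split=> a /=.
  have [K bK] := b_le.
  have H x : `|lin_comb b (tnth a) x| <= (\sum_j `|tnth a j| * K j) * `|x|.
    rewrite lin_combE (le_trans (ler_norm_sum _ _ _))// mulr_suml.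
    by apply: ler_sum => j _; rewrite normrM -mulrA ler_wpM2l//; exact: (bK j).2.
  by move=> /(dual_norm_le1 (linear_lin_comb _ lb) H).
move=> H.
have H' x : `|lin_comb b (tnth a) x| <= 1 * `|x| by rewrite mul1r.
by apply/(dual_norm_le1 (linear_lin_comb _ lb) H').
Qed.

Local Notation U := (unit_ball_coord b).

Lemma measurable_unit_ball_coord : measurable U.
Proof.
rewrite -[U]setCK; apply: measurableC; apply: measurable_tuple_open => a.
rewrite unit_ball_coordE => /existsNP[x /negP]; rewrite -ltNge => ax.
pose S := \sum_j `|b j x|; have S0 : 0 <= S by exact: sumr_ge0.
have S1 : 0 < S + 1 by rewrite ltr_wpDl.
exists ((`|lin_comb b (tnth a) x| - `|x|) / (S + 1)).
  by rewrite divr_gt0// subr_gt0.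
move=> a' aa' /(_ x); apply/negP; rewrite -ltNge.
have : `|lin_comb b (tnth a') x - lin_comb b (tnth a) x| < `|lin_comb b (tnth a) x| - `|x|.
  have -> : lin_comb b (tnth a') x - lin_comb b (tnth a) x =
      \sum_j (tnth a' j - tnth a j) * b j x.
    by rewrite !lin_combE -sumrB; apply: eq_bigr => j _; rewrite mulrBl.
  apply: (@le_lt_trans _ _ ((`|lin_comb b (tnth a) x| - `|x|) / (S + 1) * S)).
    rewrite /S mulr_sumr (le_trans (ler_norm_sum _ _ _))//.
    by apply: ler_sum => j _; rewrite normrM ler_wpM2r// ltW.
  have D0 : 0 < `|lin_comb b (tnth a) x| - `|x| by rewrite subr_gt0.
  by rewrite -[ltRHS]mulr1 -mulrA ltr_pM2l// mulrC ltr_pdivrMr// mul1r ltrDl.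
have := lerB_dist (lin_comb b (tnth a) x) (lin_comb b (tnth a) x - lin_comb b (tnth a') x).
have := ler_normB (lin_comb b (tnth a') x) (lin_comb b (tnth a') x - lin_comb b (tnth a) x).
by rewrite opprB addrCA subrr addr0; lra.
Qed.

(** The outer cube comes from biorthogonality: a functional [f] of the ball has coefficients
    $2f(e_l)$ over [psi], at most $2|e_l|$ in absolute value. The two cubes make the volume of the
    ball positive and finite. *)
Lemma unit_ball_coord_bounds : exists r M : R,
  [/\ 0 < r, 0 <= M, cube r `<=` U & U `<=` cube M].
Proof.
have [K bK] := b_le.
have K0 : 0 < 1 + \sum_j K j by rewrite ltr_pwDl// sumr_ge0// => j _; exact: (bK j).1.
have [W psiW] : exists W : 'I_n -> 'I_d -> R, forall l, psi l = lin_comb b (W l).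
  suff /choice[W WP] : forall l, exists w, psi l = lin_comb b w by exists W.
  move=> l; have : range (lin_comb psi) (psi l) by exists (fun i => (l == i)%:R) => //; exact: lin_comb_delta.
  by rewrite bV.2 => -[a _ <-]; exists a.
exists (1 + \sum_j K j)^-1, (\sum_l \sum_j (2 * `|e l|) * `|W l j|); split.
- by rewrite invr_gt0.
- by do 2 (apply: sumr_ge0 => ? _); rewrite !mulr_ge0.
- move=> a ar; rewrite unit_ball_coordE => x.
  rewrite lin_combE (le_trans (ler_norm_sum _ _ _))//.
  apply: (@le_trans _ _ ((1 + \sum_j K j)^-1 * ((\sum_j K j) * `|x|))).
    rewrite mulr_suml mulr_sumr; apply: ler_sum => j _.
    by rewrite normrM ler_pM// (bK j).2.
  by rewrite ler_pdivrMl// ler_wpM2r// lerDr.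
- move=> a; rewrite unit_ball_coordE => aU j.
  set f := lin_comb b (tnth a) in aU.
  have [w fw] : exists w, f = lin_comb psi w.
    have : range (lin_comb b) f by exists (tnth a).
    by rewrite -bV.2 => -[w _ <-]; exists w.
  have wE l : w l = 2 * f (e l) by rewrite fw lin_comb_dual mulrC divfK ?pnatr_eq0.
  have aE : tnth a = fun j => \sum_l w l * W l j.
    apply: bV.1; rewrite -/f fw; apply/funext => x; rewrite !lin_combE.
    under eq_bigr do rewrite psiW lin_combE mulr_sumr.
    rewrite exchange_big/=; apply: eq_bigr => i _; rewrite mulr_suml.
    by apply: eq_bigr => l _; rewrite mulrA.
  rewrite aE (le_trans (ler_norm_sum _ _ _))//; apply: ler_sum => l _.
  rewrite (bigD1 j)//= normrM wE normrM ger0_norm//.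
  rewrite -[leLHS]addr0 lerD//; last by apply: sumr_ge0 => ? _; rewrite !mulr_ge0.
  by rewrite ler_wpM2r// ler_wpM2l.
Qed.

Lemma unit_ball_volume : (0 < lebesgue_tuple d U < +oo)%E.
Proof.
have [r [M [r0 M0 rU UM]]] := unit_ball_coord_bounds.
have mU := measurable_unit_ball_coord.
have mcube s : measurable (cube s : set (RT d)).
  rewrite (_ : cube s = \bigcap_(i in [set: 'I_d])
     ((fun a : RT d => tnth a i) @^-1` `[- s, s]%classic)).
    apply: fin_bigcap_measurable; first exact: finite_finset.
    by move=> i _; rewrite -[X in measurable X]setTI; apply: measurable_tnth.
  apply/seteqP; split=> a /= H i; last by have := H i Logic.I; rewrite /= in_itv/= ler_norml.
  by move=> _; have := H i; rewrite /= in_itv/= ler_norml.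
apply/andP; split.
  apply: (@lt_le_trans _ _ (lebesgue_tuple d (cube r))).
    by rewrite lebesgue_tuple_cube ?ltW// lte_fin exprn_gt0// mulr_gt0.
  by apply: le_measure; rewrite ?inE.
apply: (@le_lt_trans _ _ (lebesgue_tuple d (cube M))).
  by apply: le_measure; rewrite ?inE.
by rewrite lebesgue_tuple_cube// ltry.
Qed.

Definition uniform_probability : probability (RT d) R :=
  mnormalize (mrestr (lebesgue_tuple d) measurable_unit_ball_coord)
    (dirac (point : RT d)).

Lemma uniform_probabilityE A : uniform_probability A = uniform_law b A.
Proof.
have /andP[U0 Uoo] := unit_ball_volume.
rewrite /uniform_probability/= /mnormalize.
have E S : (mrestr (lebesgue_tuple d) measurable_unit_ball_coord :
    {measure set _ -> \bar R}) S = lebesgue_tuple d (S `&` U) by [].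
rewrite !E setTI.
rewrite (gt_eqF U0) (lt_eqF Uoo)/= /uniform_law.
have Ufin : lebesgue_tuple d U \is a fin_num by rewrite ge0_fin_numE.
by rewrite -[in RHS](fineK Ufin) inver fine_eq0 ?gt_eqF.
Qed.

Lemma uniform_probability_ball : uniform_probability U = 1%E.
Proof.
have /andP[U0 Uoo] := unit_ball_volume.
rewrite uniform_probabilityE /uniform_law setIid.
by rewrite divee// ?gt_eqF// ge0_fin_numE.
Qed.

(** Dividing [slab_volume] by the volume of the ball; the contractions are directed by the
    coordinate vector of [psi l], which belongs to this symmetric convex body. *)
Lemma uniform_probability_slab l z (g x s : R) : 0 < g -> g <= `|psi l z| -> 0 < s ->
  (uniform_probability [set a | (`|lin_comb b (tnth a) z - x| <= s)%R]
    <= (12 * n%:R * s / g)%:E)%E.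
Proof.
move=> g0 gz s0; have /andP[U0 Uoo] := unit_ball_volume.
rewrite uniform_probabilityE /uniform_law.
have Ufin : lebesgue_tuple d U \is a fin_num by rewrite ge0_fin_numE.
have U1 : (0 < fine (lebesgue_tuple d U))%R by rewrite fine_gt0// U0.
rewrite -(fineK Ufin) inver gt_eqF// lee_pdivrMr// fineK//.
have [p pl] : exists p : RT d, lin_comb b (tnth p) = psi l.
  have : range (lin_comb psi) (psi l) by exists (fun i => (l == i)%:R) => //; exact: lin_comb_delta.
  rewrite bV.2 => -[a _ <-]; exists [tuple a i | i < d]; congr lin_comb.
  by apply/funext => i; rewrite tnth_mktuple.
have pairE a : dual_pairing (fun j => b j z) a = lin_comb b (tnth a) z by rewrite lin_combE.
have lin1 y : `|psi l y| <= `|y| by have [_ ->] := psie.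
have convU (lam : R) a : 0 <= lam <= 1 -> U a -> U (towards lam p a) /\ U (towards lam (tuple_opp p) a).
  move=> /andP[l0 l1]; rewrite unit_ball_coordE => aU.
  have H q : lin_comb b (tnth (towards lam p a)) q = (1 - lam) * lin_comb b (tnth a) q + lam * psi l q.
    by rewrite -pl !lin_combE; exact: dual_pairing_towards.
  have H' q : lin_comb b (tnth (towards lam (tuple_opp p) a)) q = (1 - lam) * lin_comb b (tnth a) q - lam * psi l q.
    rewrite -pl !lin_combE -mulrN.
    have := dual_pairing_towards (fun j => b j q) lam (tuple_opp p) a.
    by rewrite dual_pairing_opp.
  have l1' : 0 <= 1 - lam by rewrite subr_ge0.
  have E q : `|q| = (1 - lam) * `|q| + lam * `|q| :> R by rewrite -mulrDl subrK mul1r.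
  split=> q; rewrite ?H ?H' [leRHS]E.
    by rewrite (le_trans (ler_normD _ _))// lerD// normrM ger0_norm// ler_wpM2l.
  by rewrite (le_trans (ler_normB _ _))// lerD// normrM ger0_norm// ler_wpM2l.
have := @slab_volume R d U measurable_unit_ball_coord (fun j => b j z) p g g0 _ convU x s s0.
rewrite pairE pl setIC => /(_ gz) H; under eq_set do rewrite -pairE.
apply: le_trans H _; rewrite lee_wpmul2r ?(ltW U0)// lee_fin.
rewrite ler_wpM2r ?invr_ge0 ?(ltW g0)// ler_wpM2r ?(ltW s0)// ler_wpM2l// ler_nat.
exact: basis_size.
Qed.

End dual_system.

(** * Exponents and norming systems *)

Section log_growth.
Context {R : realType}.
Implicit Types (f : R -> \bar R) (d : R).

Lemma log_growth_lt f d : (log_growth f < d%:E)%E ->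
  \forall e \near (0:R)^'+, (f e < (e `^ (- d))%:E)%E.
Proof.
move=> /ereal_inf_lt[_ [A FA <-] Ad].
near=> e.
have e0 : 0 < e by near: e; exact: nbhs_right_gt.
have e1 : e < 1 by near: e; exact: (@nbhs_right_lt R 0 1 ltr01).
have Ae : A e by near: e; exact: FA.
have le0 : 0 < - ln e by rewrite oppr_gt0 ln_lt0// e0.
have : (lne (f e) / (- ln e)%:E < d%:E)%E.
  by apply: le_lt_trans Ad; apply: ereal_sup_ubound; exists e.
rewrite inver gt_eqF// lte_pdivrMr// -EFinM mulrN -mulNr -ln_powR.
have p0 : 0 < e `^ (- d) by rewrite powR_gt0.
have [fe0|fe0] := leP (f e) 0%E; first by move=> _; apply: le_lt_trans fe0 _; rewrite lte_fin.
rewrite -lne_EFin// lte_lne// in_itv/= leey andbT; first exact: ltW.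
by rewrite lee_fin ltW.
Unshelve. all: by end_near. Qed.

(** Counts are integers: negative growth forces them below 1, hence to 0, whose logarithm is [-oo].
    So the growth is nonnegative or [-oo], and [fine] reads the latter as 0. *)
Lemma fine_log_growth_ge0 (S : R -> set nat) :
  0 <= fine (log_growth (fun e => ereal_inf [set (n%:R%:E : \bar R) | n in S e])).
Proof.
set f := fun e : R => _.
suff : (log_growth f = -oo \/ 0 <= log_growth f)%E by case=> [->//|]; case: log_growth.
have [|lt0] := leP 0%E (log_growth f); [by right|left].
have /ereal_inf_lt[_ [A FA <-] A0] := lt0.
apply/eqP; rewrite -leeNy_eq; apply: ereal_inf_lbound.
exists (A `&` [set e | 0 < e < 1]).
  apply: filterI => //; near=> e; apply/andP; split.
    by near: e; exact: nbhs_right_gt.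
  by near: e; exact: (@nbhs_right_lt R 0 1 ltr01).
apply/eqP; rewrite -leeNy_eq; apply: ge_ereal_sup => _ [e [Ae /andP[e0 e1]] <-].
have le0 : 0 < - ln e by rewrite oppr_gt0 ln_lt0// e0.
have : (lne (f e) / (- ln e)%:E < 0)%E.
  by apply: le_lt_trans A0; apply: ereal_sup_ubound; exists e.
rewrite inver gt_eqF// lte_pdivrMr// mul0e lne_lt0.
move=> /ereal_inf_lt[_ [n Sn <-]]; rewrite lte_fin ltrn1 ltnS leqn0 => /eqP n0.
have : (f e <= 0)%E by apply: ereal_inf_lbound; exists n => //; rewrite n0.
move=> /le0_lneNy ->; rewrite mulNyr gtr0_sg ?invr_gt0// mul1e.
exact: lexx.
Unshelve. all: by end_near. Qed.

(** The condition on [theta] is strict, so it survives a small increase [eta] of both exponents: the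
    slack [F] loses at most [eta * C]. *)
Lemma intermediate_exponents (tau d theta : R) (k : nat) :
  0 <= tau -> tau < 1 -> 2 * d < k%:R -> 0 < theta ->
  theta < (1 - tau) * ((k%:R - 2 * d) / (k%:R * (1 + tau))) ->
  (0 < k)%N /\ exists t d', [/\ tau < t, t < 1, d < d' & theta * (k%:R * (1 + t)) < (1 - t) * (k%:R - 2 * d')].
Proof.
move=> tau0 tau1 dk theta0 H.
have k0 : (0 < k)%N.
  (* For $k = 0$ the quotient is 0 by the convention [0^-1 = 0], against [0 < theta]. *)
  rewrite lt0n; apply/eqP => k0; move: H; rewrite k0 mul0r invr0 !mulr0.
  by rewrite ltNge (ltW theta0).
split=> //; have kr : 0 < k%:R :> R by rewrite ltr0n.
have F0 : 0 < (1 - tau) * (k%:R - 2 * d) - theta * (k%:R * (1 + tau)).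
  move: H; rewrite mulrA ltr_pdivlMr ?subr_gt0// mulr_gt0//; lra.
set F := (X in 0 < X) in F0.
pose C := (k%:R - 2 * d) + 2 * (1 - tau) + theta * k%:R.
have C0 : 0 < C by rewrite /C; have := mulr_gt0 theta0 kr; lra.
have [eta [eta0 e1 e2]] : exists eta, [/\ 0 < eta, eta <= (1 - tau) / 2 & 2 * (eta * C) <= F].
  exists (Num.min (F / (2 * C)) ((1 - tau) / 2)); split.
  - by rewrite lt_min !divr_gt0//= ?mulr_gt0 ?subr_gt0.
  - by rewrite ge_min lexx orbT.
  - by rewrite mulrCA -ler_pdivlMr ?mulr_gt0// ge_min lexx.
exists (tau + eta), (d + eta); split; [lra|lra|lra|].
have e3 : 0 < eta * C by rewrite mulr_gt0.
have e4 : 0 <= 2 * eta ^+ 2 by rewrite mulr_ge0// sqr_ge0.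
rewrite -subr_gt0 [ltRHS](_ : _ = F - eta * C + 2 * eta ^+ 2); first lra.
by rewrite /F /C; ring.
Qed.

End log_growth.

Section norming_systems.
Context {R : realType} {B : normedModType R}.

Lemma covering_growth (X : set B) (d : R) : (box_dim X < d%:E)%E ->
  \forall r \near (0:R)^'+, exists n (c : 'I_n -> B),
    [/\ n%:R < r `^ (- d), forall j, X (c j) & X `<=` \bigcup_j ball (c j) r].
Proof.
move=> /log_growth_lt; apply: filterS => r /ereal_inf_lt[_ [n [c [Xc cX]] <-]].
by rewrite lte_fin => nr; exists n, c.
Qed.

Lemma approximating_subspace (X : set B) (t : R) : (thickness X < t%:E)%E ->
  \forall r \near (0:R)^'+, exists n (b : 'I_n -> B),
    [/\ n%:R < r `^ (- t), injective (lin_comb b) &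
        forall x, X x -> exists a, `|x - lin_comb b a| < 2 * r].
Proof.
move=> /log_growth_lt H; near=> r.
have r0 : 0 < r by near: r; exact: nbhs_right_gt.
have : (approx_dim X r < (r `^ (- t))%:E)%E by near: r.
move=> /ereal_inf_lt[_ [n [V [[b [injb VE]] VX]] <-]]; rewrite lte_fin => nr.
exists n, b; split=> // x Xx; have := VX x Xx; rewrite /dist => xV.
(* [dist] is an infimum; the factor 2 in the statement leaves room for a vector that nearly attains
   it. *)
have [|_ [v Vv <-] xv] := @inf_adherent _ [set `|x - v| | v in V] r r0.
  split; first by exists `|x - 0|, 0 => //; rewrite VE; exists (fun=> 0) => //; exact: lin_comb0.
  by exists 0 => _ [v _ <-].
have {}xv : `|x - v| < 2 * r by apply: lt_le_trans xv _; lra.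
by move: Vv xv; rewrite VE => -[a _ <-] xv; exists a.
Unshelve. all: by end_near. Qed.

(** [delta] solves $\delta^{1-t} = \epsilon/64$, so that $n \le \delta^{-t}$ is the stated bound and
    $n\delta \le \epsilon/64$. A difference $z$ is within $4\delta$ of some $v$ in the subspace, and
    some $\psi_l$ has $|\psi_l v| \ge |v|/(3n)$. Then $12n|\psi_l z| \ge 4|v| - 48n\delta \ge
    2\epsilon - 16\delta - 48n\delta \ge \epsilon$, which is the origin of 64. *)
Lemma norming_system (X : set B) (t : R) : 0 <= t -> t < 1 -> (thickness X < t%:E)%E ->
  exists2 e0 : R, 0 < e0 & forall eps, 0 < eps -> eps < e0 ->
    exists n (psi : 'I_n -> B -> R^o) (e : 'I_n -> B),
    [/\ dual_system psi e, n%:R <= (eps / 64) `^ (- (t / (1 - t))) &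
        forall x y, X x -> X y -> eps / 2 <= `|x - y| ->
          exists2 l, (0 < n)%N & eps / (12 * n%:R) <= `|psi l (x - y)| ].
Proof.
move=> t0 t1 /approximating_subspace[r /= r0 rP].
(* For [eps] below 1, the exponent $1/(1-t) \ge 1$ gives $\delta \le \epsilon/64$. *)
exists (Num.min r 1); first by rewrite lt_min r0 ltr01.
move=> eps eps0; rewrite lt_min => /andP[epsr eps1].
have t1' : 0 < 1 - t by rewrite subr_gt0.
pose delta := (eps / 64) `^ (1 - t)^-1.
have e64 : 0 < eps / 64 by rewrite divr_gt0.
have delta0 : 0 < delta by rewrite powR_gt0.
have d64 : delta <= eps / 64.
  rewrite /delta -[leRHS]powRr1 ?(ltW e64)//; apply: ger_powR; first by apply/andP; split => //; lra.
  by rewrite -[leLHS]invr1 lef_pV2 ?posrE//; lra.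
have dr : delta < r by apply: le_lt_trans d64 _; lra.
have [|n [b [nd injb bX]]] := rP delta _ delta0.
  by rewrite /= sub0r normrN gtr0_norm.
have [psi [e [lpsi psi1 psie psib]]] := norming_functionals injb.
exists n, psi, e; split.
- by split.
- apply: ltW; move: nd; rewrite /delta -powRrM.
  by congr (_ < _ `^ _); field; rewrite gt_eqF.
move=> x y Xx Xy xy.
have nd1 : n%:R * delta <= eps / 64.
  have -> : eps / 64 = delta `^ (- t) * delta.
    rewrite -[X in _ = _ * X]powRr1 ?(ltW delta0)// -powRD; last by apply/implyP => _; rewrite gt_eqF.
    by rewrite addrC /delta -powRrM mulVf ?gt_eqF// powRr1 ?(ltW e64).
  by rewrite ler_wpM2r// ltW.
have [a1 xa1] := bX x Xx; have [a2 ya2] := bX y Xy.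
pose a := fun j => (-1) * a2 j + a1 j.
pose v := lin_comb b a.
have vE : v = lin_comb b a1 - lin_comb b a2.
  by rewrite /v lin_comb_lin scaleN1r addrC.
have zv : `|(x - y) - v| < 4 * delta.
  have -> : x - y - v = (x - lin_comb b a1) - (y - lin_comb b a2).
    by rewrite vE !opprB addrACA [RHS]addrACA [X in _ + X]addrC.
  apply: le_lt_trans (ler_normB _ _) _; lra.
have v0 : eps / 2 - 4 * delta <= `|v|.
  have := lerB_dist (x - y) ((x - y) - v); rewrite opprB addrCA subrr addr0; lra.
have n0 : (0 < n)%N.
  rewrite lt0n; apply/eqP => n0; have := psib a; rewrite big1.
    by rewrite mulr0 -/v; lra.
  by move=> l _; exfalso; have := ltn_ord l; rewrite {2}n0 ltn0.
have nr0 : 0 < n%:R :> R by rewrite ltr0n.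
have [l vl] : exists l, `|v| <= 3 * n%:R * `|psi l v|.
  apply: contrapT => /forallNP vl; have := psib a; rewrite -/v leNgt => /negP; apply.
  have v1 : 0 < `|v| by lra.
  apply: (@le_lt_trans _ _ (2 * \sum_(l < n) `|v| / (3 * n%:R))).
    rewrite ler_wpM2l//; apply: ler_sum => l _; have /negP := vl l.
    rewrite -ltNge => /ltW; rewrite ler_pdivlMr ?mulr_gt0//; by rewrite mulrC.
  rewrite sumr_const card_ord -[_ *+ n]mulr_natl.
  have -> : 2 * (n%:R * (`|v| / (3 * n%:R))) = 2 / 3 * `|v| by field; rewrite gt_eqF.
  lra.
exists l => //.
rewrite ler_pdivrMr ?mulr_gt0//.
have lin : psi l (x - y) - psi l ((x - y) - v) = psi l v.
  by rewrite -(linearB_eq _ _ (lpsi l)) opprB addrCA subrr addr0.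
have := lerB_dist (psi l v) (- psi l ((x - y) - v)); rewrite opprK normrN.
rewrite -lin subrK lin => vz.
have := psi1 l ((x - y) - v) => pz.
have nz : n%:R * `|psi l v| - n%:R * (4 * delta) <= n%:R * `|psi l (x - y)|.
  by rewrite -mulrBr ler_wpM2l// ltW//; lra.
lra.
Qed.

End norming_systems.

(** * Series and scales *)

Section weighted_series.
Context {R : realType}.
Implicit Types (u : nat -> R) (r : R).

(** A telescoping majorant of the weights; with $x = N+1$ it amounts to $x + 1 \le 2x$. *)
Let weight_le N : N.+1%:R ^- 2 <= 2 / N.+1%:R - 2 / N.+2%:R :> R.
Proof.
have n0 : 0 < N.+1%:R :> R by rewrite ltr0n.
have n1 : N.+2%:R = N.+1%:R + 1 :> R by rewrite natr1.
rewrite n1; set x : R := N.+1%:R in n0 n1 *.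
have x1 : 1 <= x by rewrite ler1n.
have -> : 2 / x - 2 / (x + 1) = 2 / (x * (x + 1)).
  by field; rewrite !gt_eqF// addr_gt0.
rewrite -[leLHS]mul1r ler_pdivrMr ?exprn_gt0// mulrAC ler_pdivlMr ?mulr_gt0 ?addr_gt0//.
rewrite mul1r; nra.
Qed.

Lemma weighted_tail u r : (forall n, `|u n| <= r) -> forall N M, (N <= M)%N ->
  \sum_(N <= n < M) `|n.+1%:R ^- 2 * u n| <= 2 * r / N.+1%:R.
Proof.
move=> ur N M NM; have r0 : 0 <= r by apply: le_trans (ur 0%N).
suff : \sum_(N <= n < M) `|n.+1%:R ^- 2 * u n| <= r * (2 / N.+1%:R - 2 / M.+1%:R).
  move=> /le_trans; apply; rewrite (mulrC 2 r) -mulrA ler_wpM2l// gerBl.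
  by rewrite divr_ge0.
rewrite -(subnKC NM); elim: (M - N)%N => [|m IH].
  by rewrite addn0 big_geq// subrr mulr0.
rewrite addnS big_nat_recr/= ?leq_addr//; apply: le_trans (lerD IH (_ : _ <= r * (2 / (N + m).+1%:R - 2 / (N + m).+2%:R))) _.
  by rewrite normrM mulrC ler_pM// ger0_norm ?invr_ge0 ?exprn_ge0.
by rewrite -mulrDr addrA subrK.
Qed.

Lemma weighted_series_cvg u r : (forall n, `|u n| <= r) ->
  cvgn (series (fun n => n.+1%:R ^- 2 * u n : R^o)).
Proof.
move=> ur; apply: normed_cvg; apply: nondecreasing_is_cvgn.
  by apply: nondecreasing_series => n _ /=.
exists (2 * r / 1%:R) => _ [n _ <-]; exact: weighted_tail.
Qed.

Lemma weighted_series_tail u r N : (forall n, `|u n| <= r) ->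
  `|limn (series (fun n => n.+1%:R ^- 2 * u n : R^o)) -
    \sum_(0 <= n < N) n.+1%:R ^- 2 * u n| <= 2 * r / N.+1%:R.
Proof.
move=> ur; set s := series _; set sN := \sum_(0 <= n < N) _.
have cs : cvgn s := weighted_series_cvg ur.
have : (fun M => `|s M - sN|) @ \oo --> `|limn s - sN|.
  by apply: cvg_norm; apply: cvgB => //; exact: cvg_cst.
move=> /cvg_lim <- //; apply: limr_le.
  by apply: is_cvg_norm; apply: is_cvgB => //; exact: is_cvg_cst.
near=> M; have NM : (N <= M)%N by near: M; exact: nbhs_infty_ge.
rewrite /s /series/= (@big_cat_nat _ _ _ N)//= addrC addrK.
by apply: le_trans (ler_norm_sum _ _ _) _; exact: weighted_tail.
Unshelve. all: by end_near. Qed.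

Lemma weighted_series_le u r : (forall n, `|u n| <= r) ->
  `|limn (series (fun n => n.+1%:R ^- 2 * u n : R^o))| <= 2 * r.
Proof.
by move=> /(@weighted_series_tail u r 0); rewrite big_geq// subr0 divr1.
Qed.

End weighted_series.

Section numeric.
Context {R : realType}.

(** Half of the decay, $\sqrt{a}^{\,j}$, is spent on the polynomial. By induction on the degree,
    each factor $j+1$ costs one more square root, since $(j+1)q^j \le \sum_{i \le j} q^i \le
    1/(1-q)$. *)
Lemma poly_geometric_bound (m : nat) (a : R) : 0 < a -> a < 1 ->
  exists C r : R, [/\ 0 < C, 0 < r, r < 1 & forall j, j.+1%:R ^+ m * a ^+ j <= C * r ^+ j].
Proof.
move=> a0 a1; pose r := Num.sqrt a.
have r0 : 0 < r by rewrite sqrtr_gt0.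
have r1 : r < 1 by rewrite -sqrtr1 ltr_sqrt.
have ar : a = r * r by rewrite -expr2 sqr_sqrtr// ltW.
suff [C C0 HC] : exists2 C, 0 < C & forall j, j.+1%:R ^+ m * r ^+ j <= C.
  exists C, r; split=> // j; rewrite ar exprMn mulrA ler_wpM2r//.
  by rewrite exprn_ge0// ltW.
elim: m r r0 r1 {ar} => [|m IH] r r0 r1.
  exists 1 => // j; rewrite expr0 mul1r exprn_ile1//; exact: ltW.
pose q := Num.sqrt r.
have q0 : 0 < q by rewrite sqrtr_gt0.
have q1 : q < 1 by rewrite -sqrtr1 ltr_sqrt.
have rq : r = q * q by rewrite -expr2 sqr_sqrtr// ltW.
have [C C0 HC] := IH q q0 q1.
have D0 : 0 < (1 - q)^-1 by rewrite invr_gt0 subr_gt0.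
have H j : j.+1%:R * q ^+ j <= (1 - q)^-1.
  rewrite -[leRHS]mul1r ler_pdivlMr ?subr_gt0//.
  suff : j.+1%:R * (1 - q) * q ^+ j <= 1 - q ^+ j.+1.
    by rewrite mulrAC => /le_trans; apply; rewrite gerBl exprn_ge0// ltW.
  have -> : 1 - q ^+ j.+1 = (1 - q) * \sum_(i < j.+1) q ^+ i by rewrite -[LHS]opprB subrX1 -mulNr opprB.
  rewrite (mulrC j.+1%:R) -mulrA ler_wpM2l ?subr_ge0 ?(ltW q1)//.
  have -> : j.+1%:R * q ^+ j = \sum_(i < j.+1) q ^+ j by rewrite sumr_const card_ord mulr_natl.
  apply: ler_sum => i _.
  apply: ler_wiXn2l; [exact: ltW|exact: ltW|].
  by rewrite -ltnS.
exists (C * (1 - q)^-1); first by rewrite mulr_gt0.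
move=> j; rewrite rq exprMn exprSr mulrACA mulrC [leRHS]mulrC.
apply: ler_pM => //; first by rewrite mulr_ge0// exprn_ge0// ltW.
by rewrite mulr_ge0 ?exprn_ge0// ltW.
Qed.

Lemma nneseries_geometric_lty (C r : R) (f : nat -> \bar R) : 0 < r -> r < 1 ->
  (forall j, 0 <= f j)%E -> (forall j, f j <= (C * r ^+ j)%:E)%E ->
  (\sum_(j <oo) f j < +oo)%E.
Proof.
move=> r0 r1 f0 fC.
have C0 : 0 <= C by have := le_trans (f0 0%N) (fC 0%N); rewrite expr0 mulr1 lee_fin.
apply: (@le_lt_trans _ _ (C / (1 - r))%:E); last exact: ltry.
apply: lime_le; first by apply: is_cvg_nneseries => n _ _; exact: f0.
apply: nearW => n; apply: (@le_trans _ _ (\sum_(0 <= j < n) (C * r ^+ j)%:E)%E).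
  by apply: lee_sum => j _; exact: fC.
rewrite sumEFin lee_fin -mulr_sumr ler_wpM2l// -[leRHS]mul1r ler_pdivlMr ?subr_gt0//.
rewrite big_mkord mulrC (_ : (1 - r) * _ = 1 - r ^+ n).
  by rewrite gerBl exprn_ge0// ltW.
by rewrite -[RHS]opprB subrX1 -mulNr opprB.
Qed.

End numeric.

Section hoelder_from_scales.
Context {R : realType} {B : normedModType R}.

(** Below $2^{-n_0}$, the least [j] with $2^{-j} \le |x-y|$ satisfies $|x-y| \le 2 \cdot 2^{-j}$,
    whence the constant 2; larger distances are compared with the scale [n0] through the bound [D],
    whence $|D|\,2^{n_0}$. *)
Lemma hoelder_from_scales (X : set B) (theta D : R) (n0 : nat) (N : B -> B -> R) :
  0 < theta -> (forall x y, 0 <= N x y) ->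
  (forall x y, X x -> X y -> `|x - y| <= D) ->
  (forall j x y, (n0 <= j)%N -> X x -> X y -> 2^-1 ^+ j <= `|x - y| ->
     (2^-1 ^+ j) `^ theta^-1 <= N x y) ->
  exists C : R, 0 < C /\ forall x y, X x -> X y -> `|x - y| <= C * N x y `^ theta.
Proof.
move=> theta0 N0 XD H.
have half0 j : 0 < 2^-1 ^+ j :> R by rewrite exprn_gt0// invr_gt0.
have Hp j x y : (n0 <= j)%N -> X x -> X y -> 2^-1 ^+ j <= `|x - y| ->
    2^-1 ^+ j <= N x y `^ theta.
  move=> nj Xx Xy xy; have := H j x y nj Xx Xy xy.
  move=> /(ge0_ler_powR (ltW theta0) (powR_ge0 _ _) (N0 _ _)).
  by rewrite -powRrM mulVf ?gt_eqF// powRr1// ltW.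
have C0 : 0 < 2 + `|D| * 2 ^+ n0 by rewrite ltr_wpDr// mulr_ge0// exprn_ge0.
exists (2 + `|D| * 2 ^+ n0); split => //.
move=> x y Xx Xy.
have Np : 0 <= N x y `^ theta by exact: powR_ge0.
have [big|small] := leP (2^-1 ^+ n0) `|x - y|.
  apply: (@le_trans _ _ (`|D| * 2 ^+ n0 * N x y `^ theta)); last first.
    by rewrite ler_wpM2r// lerDr.
  apply: (@le_trans _ _ (`|D| * 2 ^+ n0 * 2^-1 ^+ n0)).
    by rewrite -mulrA -exprMn mulfV// expr1n mulr1 (le_trans (XD _ _ Xx Xy))// ler_norm.
  by rewrite ler_wpM2l// ?mulr_ge0 ?exprn_ge0//; exact: Hp.
have [->|xy0] := eqVneq x y.
  by rewrite subrr normr0 mulr_ge0 ?powR_ge0 ?(ltW C0).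
have xyp : 0 < `|x - y| by rewrite normr_gt0 subr_eq0.
have ex : exists j, 2^-1 ^+ j <= `|x - y|.
  have := cvg_geometric 1 (_ : `|2^-1 : R| < 1).
  rewrite ger0_norm ?invr_ge0// invf_lt1 ?ltr1n// => /(_ isT).
  move=> /cvgr0_norm_le/(_ _ xyp)[j _ /(_ j (leqnn _))].
  by rewrite /geometric/= mul1r ger0_norm ?(ltW (half0 j))// => Hj; exists j.
case: (ex_minnP ex) => j xj jmin.
have j0 : (n0 < j)%N.
  rewrite ltnNge; apply/negP => jn; have := le_lt_trans xj small; apply/negP; rewrite -leNgt.
  by apply: ler_wiXn2l; rewrite ?invr_ge0// invf_le1// ler1n.
have jx : `|x - y| <= 2 * 2^-1 ^+ j.
  case: j xj jmin j0 => // j xj jmin _.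
  rewrite exprS mulrA mulfV// mul1r leNgt; apply/negP => /ltW/jmin.
  by rewrite ltnn.
apply: (le_trans jx); apply: (@le_trans _ _ (2 * N x y `^ theta)).
  by rewrite ler_wpM2l//; apply: Hp => //; exact: ltnW.
by rewrite ler_wpM2r// lerDl mulr_ge0// exprn_ge0.
Qed.

End hoelder_from_scales.

(** * The law of the coordinates *)

Section finite_union.
Context d (T : measurableType d) (R : realType) (mu : {measure set T -> \bar R}).

Lemma measure_bigsetU_le (I : Type) (s : seq I) (F : I -> set T) (c : R) :
  (forall i, measurable (F i)) -> (forall i, mu (F i) <= c%:E)%E ->
  measurable (\big[setU/set0]_(i <- s) F i) /\
  (mu (\big[setU/set0]_(i <- s) F i) <= ((size s)%:R * c)%:E)%E.
Proof.
move=> mF Fc; elim: s => [|i s [IH1 IH2]].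
  by rewrite big_nil measure0 mul0r.
rewrite big_cons; split; first exact: measurableU.
apply: (le_trans (measureU2 _ _ _)) => //.
by rewrite /= -natr1 mulrDl mul1r addrC EFinD leeD.
Qed.

End finite_union.

Section curried_law.
Context {R : realType} (k : nat) (d : nat -> nat).
Local Notation RT n := (n.-tuple (measurableTypeR R)).
Local Notation index := ('I_k * nat)%type.
Local Notation T := (fun p : index => RT (d p.2)).
Variable P : forall p : index, probability (T p) R.
Local Notation Om := (familyType T).
Local Notation Co := (coordsType (R := R) k d).

(** The product is built over the countable type of pairs $(i, n)$, whereas [coordsType] is curried;
    the law is transported along this bijection. *)
Definition curry_family (a : Om) : Co := fun i n => a (i, n).
Definition uncurry_family (c : Co) : Om := fun p => c p.1 p.2.

Lemma curry_familyK : cancel curry_family uncurry_family.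
Proof. by move=> a; apply: functional_extensionality_dep => -[i n]. Qed.

Lemma measurable_curry_family : measurable_fun setT curry_family.
Proof.
apply: (@measurability _ _ _ _ setT curry_family (@coords_gen R k d)) => //.
move=> _ [_ [i [n [A [mA ->]]]] <-].
exact: (@measurable_coordinate _ _ T (i, n) measurableT A mA).
Qed.

Lemma measurable_uncurry_family : measurable_fun setT uncurry_family.
Proof.
apply: measurable_familyP => -[i n] _ A mA; rewrite setTI.
by apply: sub_sigma_algebra; exists i, n, A.
Qed.

Definition coords_law (A : set Co) : \bar R :=
  product_law P (curry_family @^-1` A).

Let mpre (A : set Co) : measurable A -> measurable (curry_family @^-1` A).
Proof. by move=> mA; rewrite -[X in measurable X]setTI; exact: measurable_curry_family. Qed.

Let coords_law0 : coords_law set0 = 0%E.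
Proof. by rewrite /coords_law preimage_set0 measure0. Qed.

Let coords_law_ge0 A : (0 <= coords_law A)%E.
Proof. exact: measure_ge0. Qed.

Let coords_law_sigma_additive : semi_sigma_additive coords_law.
Proof.
move=> F mF tF mUF; rewrite /coords_law preimage_bigcup.
apply: measure_semi_sigma_additive.
- by move=> i; exact: mpre.
- apply/trivIsetP => i j _ _ ij; rewrite -preimage_setI.
  by move/trivIsetP : tF => /(_ _ _ _ _ ij) ->//; rewrite preimage_set0.
- by rewrite -preimage_bigcup; exact: mpre.
Qed.

HB.instance Definition _ := isMeasure.Build _ Co R coords_law
  coords_law0 coords_law_ge0 coords_law_sigma_additive.

Let coords_lawT : coords_law setT = 1%E.
Proof. by rewrite /coords_law preimage_setT product_lawT. Qed.

HB.instance Definition _ := Measure_isProbability.Build _ Co R coords_law coords_lawT.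

Lemma coords_law_negligible (A : set Om) : (product_law P).-negligible A ->
  coords_law.-negligible (uncurry_family @^-1` A).
Proof.
move=> [N [mN N0 AN]]; exists (uncurry_family @^-1` N); split.
- by rewrite -[X in measurable X]setTI; exact: measurable_uncurry_family.
- rewrite /coords_law (_ : _ @^-1` _ = N)//.
  by apply/seteqP; split=> a /=; rewrite curry_familyK.
- by move=> c; exact: AN.
Qed.

Lemma coords_law_cylinder (N : nat) (A : 'I_k -> forall n, set (RT (d n))) :
  (forall i n, measurable (A i n)) ->
  coords_law [set a | forall i n, (n < N)%N -> A i n (a i n)] =
  (\prod_(i < k) \prod_(n < N) P (i, n : nat) (A i n))%E.
Proof.
move=> mA; pose A' (p : index) := A p.1 p.2.
pose s : seq index := [seq (i, n) | i <- index_enum 'I_k, n <- iota 0 N].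
have us : uniq s.
  apply: allpairs_uniq; [exact: index_enum_uniq|exact: iota_uniq|].
  by move=> [? ?] [? ?] _ _ [-> ->].
transitivity (product_law P [set a | forall p, p \in s -> A' p (a p)]).
  congr (product_law P _); apply/seteqP; split=> a /= H.
    move=> [i n] /allpairsP[[i' n'] [/= _ + [-> ->]]].
    by rewrite mem_iota add0n => /andP[_ nN]; exact: H.
  move=> i n nN; apply: (H (i, n)); apply/allpairsP; exists (i, n); split => //=.
    by rewrite mem_index_enum.
  by rewrite mem_iota.
rewrite product_law_coordinates//; last by move=> p; exact: mA.
rewrite big_allpairs_dep/=; apply: eq_bigr => i _.
by rewrite -[X in iota 0 X]subn0 -/(index_iota 0 N) big_mkord.
Qed.

End curried_law.

(** * Small values of the random map *)

Section random_map.
Context {R : realType} {B : normedModType R} (k : nat).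
Local Notation RT n := (n.-tuple (measurableTypeR R)).
Variables (n : nat -> nat) (psi : forall j, 'I_(n j) -> B -> R^o) (e : forall j, 'I_(n j) -> B).
Hypothesis sys : forall j, dual_system (@psi j) (@e j).
Variables (d : nat -> nat) (b : forall j, 'I_(d j) -> B -> R^o).
Hypothesis bV : forall j, is_basis (@b j) (range (lin_comb (@psi j))).
Local Notation index := ('I_k * nat)%type.
Local Notation T := (fun p : index => RT (d p.2)).
Local Notation Om := (familyType T).

Definition coordinate_law (p : index) : probability (T p) R :=
  uniform_probability (@sys p.2) (@bV p.2).

Local Notation upd a i j t := (@update _ _ T a (i, j) t : Om).
Local Notation mu0 := (product_law coordinate_law).

Definition functional_of (a : Om) (i : 'I_k) (j : nat) (x : B) : R :=
  lin_comb (@b j) (tnth (a (i, j))) x.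

(** Truncated rows: the bad events are expressed through these finite sums instead of the limits. *)
Definition partial_map N (i : 'I_k) (a : Om) (z : B) : R :=
  \sum_(0 <= j < N) j.+1%:R ^- 2 * functional_of a i j z.

Lemma measurable_partial_map N i z :
  measurable_fun setT (fun a : Om => partial_map N i a z).
Proof.
apply: measurable_sum => j; apply: measurable_funM; first exact: measurable_cst.
apply: (eq_measurable_fun (dual_pairing (fun l => @b j l z) \o (fun a : Om => a (i, j)))).
  by move=> a _; rewrite /functional_of lin_combE.
apply: measurableT_comp; first exact: measurable_dual_pairing.
exact: (@measurable_coordinate _ _ T (i, j)).
Qed.

Definition slab_event N i z s : set Om := [set a | `|partial_map N i a z| <= s].

Lemma measurable_slab_event N i z s : measurable (slab_event N i z s).
Proof.
rewrite (_ : slab_event N i z s = (fun a : Om => partial_map N i a z) @^-1` `[- s, s]%classic).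
  by rewrite -[X in measurable X]setTI; apply: measurable_partial_map.
by apply/seteqP; split=> a; rewrite /slab_event/= in_itv/= ler_norml.
Qed.

Lemma functional_of_update (a : Om) i j (t : RT (d j)) x :
  functional_of (upd a i j t) i j x = lin_comb (@b j) (tnth t) x.
Proof. by rewrite /functional_of updateE. Qed.

Lemma functional_of_update_other (a : Om) i j (t : RT (d j)) i' j' x :
  (i', j') != (i, j) -> functional_of (upd a i j t) i' j' x = functional_of a i' j' x.
Proof. by move=> ij; rewrite /functional_of update_other// eq_sym. Qed.

Lemma slab_event_update_other N i z s (a : Om) i' j (t : RT (d j)) : i != i' ->
  slab_event N i z s (upd a i' j t) <-> slab_event N i z s a.
Proof.
move=> ii'; rewrite /slab_event/= /partial_map.
under eq_bigr => l _.
  rewrite functional_of_update_other; last by apply: contra ii' => /eqP[->].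
  over.
by [].
Qed.

(** With all other coordinates frozen, the truncated row at [z] is $(j+1)^{-2}\phi z$ plus a
    constant, with $\phi$ uniform in the ball of the span of [psi j]: the event is a slab of
    half-width $s(j+1)^2$ centred at a fixed value. *)
Lemma slab_event_section N i j l z s (g : R) (a : Om) :
  (j < N)%N -> 0 < g -> g <= `|@psi j l z| -> 0 < s ->
  (coordinate_law (i, j) [set t | slab_event N i z s (upd a i j t)]
    <= (12 * (n j)%:R * (s * j.+1%:R ^+ 2) / g)%:E)%E.
Proof.
move=> jN g0 gz s0.
have j0 : 0 < j.+1%:R ^+ 2 :> R by rewrite exprn_gt0// ltr0n.
pose rest := \sum_(0 <= l < N | l != j) l.+1%:R ^- 2 * functional_of a i l z.
have splitE (t : RT (d j)) : partial_map N i (upd a i j t) z =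
    j.+1%:R ^- 2 * (lin_comb (@b j) (tnth t) z - - (j.+1%:R ^+ 2 * rest)).
  rewrite /partial_map (bigD1_seq j)/= ?mem_index_iota ?iota_uniq// functional_of_update.
  rewrite opprK mulrDr mulrA mulVf ?gt_eqF// mul1r; congr (_ + _).
  apply: eq_bigr => m mj; rewrite functional_of_update_other//.
  by apply: contra mj => /eqP[->].
rewrite (_ : [set t | _] =
    [set t | `|lin_comb (@b j) (tnth t) z - - (j.+1%:R ^+ 2 * rest)| <= s * j.+1%:R ^+ 2]).
  exact: (uniform_probability_slab (@sys j) (@bV j) _ g0 gz (mulr_gt0 s0 j0)).
apply/seteqP; split=> t;
  by rewrite /slab_event/= splitE normrM ger0_norm ?invr_ge0 ?(ltW j0)// ler_pdivrMl// (mulrC _ s).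
Qed.

(* The rows of the random map are independent, whence the [k]-th power. *)
Lemma slab_events_le N j l z s (g : R) :
  (j < N)%N -> 0 < g -> g <= `|@psi j l z| -> 0 < s ->
  (mu0 [set a | forall i, slab_event N i z s a]
    <= ((12 * (n j)%:R * (s * j.+1%:R ^+ 2) / g) ^+ k)%:E)%E.
Proof.
move=> jN g0 gz s0; set q := 12 * _ * _ / g.
have q0 : 0 <= q by rewrite divr_ge0 ?mulr_ge0 ?exprn_ge0 ?(ltW g0) ?(ltW s0).
have mcap (r : seq 'I_k) : measurable [set a : Om | forall i, i \in r -> slab_event N i z s a].
  rewrite (_ : [set a | _] = \bigcap_(i in [set` r]) slab_event N i z s).
    by apply: fin_bigcap_measurable => [|i _]; [exact: finite_seq|exact: measurable_slab_event].
  by apply/seteqP; split.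
suff H (r : seq 'I_k) : uniq r ->
    (mu0 [set a | forall i, i \in r -> slab_event N i z s a] <= (q ^+ size r)%:E)%E.
  have := H (index_enum 'I_k) (index_enum_uniq _).
  rewrite -[index_enum _]enumT size_enum_ord.
  congr (mu0 _ <= _)%E; apply/seteqP; split=> a /= aP i; last by move=> _.
  by apply: aP; rewrite mem_enum.
elim: r => [_|i r IH /= /andP[ir ur]].
  rewrite expr0 (_ : [set a | _] = setT); first by rewrite [leLHS]product_lawT.
  by apply/seteqP; split.
rewrite (_ : [set a | _] = slab_event N i z s `&`
    [set a | forall i, i \in r -> slab_event N i z s a]); last first.
  apply/seteqP; split=> [a H|a [Hi H] i'].
    by split=> [|i' i'r]; apply: H; rewrite inE ?eqxx// i'r orbT.
  by rewrite inE => /predU1P[->//|]; exact: H.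
apply: (@le_trans _ _ (q%:E * mu0 [set a | forall i, i \in r -> slab_event N i z s a])%E).
  (* Only coordinate [(i, j)] of row [i] is integrated; the events of the other rows ignore it. *)
  apply: (@product_law_setI_le _ _ _ T coordinate_law (i, j)) => //.
  - exact: measurable_slab_event.
  - move=> a t; have ne i' : i' \in r -> i' != i by apply: contraTneq => ->.
    split=> H i' i'r; first exact/(slab_event_update_other _ _ _ _ _ (ne _ i'r))/H.
    exact/(slab_event_update_other _ _ _ _ _ (ne _ i'r))/H.
  - by move=> a; exact: (@slab_event_section N i j l z s g a jN g0 gz s0).
by rewrite exprS [leRHS]EFinM lee_wpmul2l ?lee_fin// IH.
Qed.

Definition in_unit_balls : set Om := [set a | forall p : index, unit_ball_coord (@b p.2) (a p)].

(** There are countably many coordinates, and each lies in its ball with probability 1. *)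
Lemma in_unit_balls_negligible : mu0.-negligible (~` in_unit_balls).
Proof.
pose F m : set Om := if unpickle m is Some p
  then ~` [set a | unit_ball_coord (@b (p : index).2) (a p)] else set0.
have -> : ~` in_unit_balls = \bigcup_m F m.
  apply/seteqP; split=> [a /existsNP[p ap]|a [m _]].
    by exists (pickle p) => //; rewrite /F pickleK.
  by rewrite /F; case: unpickle => [p ap H|//]; exact: (ap (H p)).
apply: negligible_bigcup => m; rewrite /F; case: unpickle => [p|]; last exact: negligible_set0.
have mUp : measurable (unit_ball_coord (@b p.2)) := measurable_unit_ball_coord (@sys p.2) (@bV p.2).
have mC : measurable [set a : Om | unit_ball_coord (@b p.2) (a p)].
  exact: (@cylinder_coordinate _ _ T p _ mUp).1.
apply/negligibleP; first exact: measurableC.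
rewrite [LHS]probability_setC//.
have := @product_law_setI _ _ _ T coordinate_law p _ setT mUp measurableT (fun _ _ => iff_refl _).
rewrite setIT [X in (_ * X)%E](product_lawT coordinate_law) mule1 => E.
rewrite [X in (1 - X)%E]E [X in (1 - X)%E]uniform_probability_ball subee//.
Qed.

End random_map.

(** * Bad events *)

Section scales.
Context {R : realType}.
Implicit Types (theta : R).

Lemma half_expn_gt0 j : 0 < 2^-1 ^+ j :> R.
Proof. by rewrite exprn_gt0// invr_gt0. Qed.

Lemma near_half_powR theta (Q : R -> Prop) : 0 < theta ->
  (\forall r \near (0:R)^'+, Q r) ->
  exists J : nat, forall j, (J <= j)%N -> Q ((2^-1 ^+ j) `^ theta^-1).
Proof.
move=> theta0 [r /= r0 rQ].
have := cvg_geometric 1 (_ : `|2^-1 : R| < 1).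
rewrite ger0_norm ?invr_ge0// invf_lt1 ?ltr1n// => /(_ isT).
have rt : 0 < r `^ theta by rewrite powR_gt0.
move=> /cvgr0_norm_lt/(_ _ rt)[J _ HJ].
exists J => j Jj; apply: rQ; last by rewrite powR_gt0// half_expn_gt0.
have := HJ j Jj; rewrite /geometric/= mul1r ger0_norm ?(ltW (half_expn_gt0 j))// => Hj.
rewrite /= sub0r normrN ger0_norm ?powR_ge0//.
have -> : r = (r `^ theta) `^ theta^-1 by rewrite -powRrM mulfV ?gt_eqF// powRr1// ltW.
by apply: gt0_ltr_powR; rewrite ?invr_gt0// nnegrE ?powR_ge0// ltW// half_expn_gt0.
Qed.

(** With $u = t/(1-t)$, one has $m^2 \le \epsilon^{-2d/\theta}$, and the other factor is
    $(\epsilon^{1/\theta - 1 - 2u})^k$ up to constants and powers of $j+1$. The total exponent is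
    [kappa], positive exactly under the hypothesis. *)
Lemma scale_estimate (t d theta : R) (k : nat) : t < 1 -> 0 < theta ->
  theta * (k%:R * (1 + t)) < (1 - t) * (k%:R - 2 * d) ->
  exists C r : R, [/\ 0 < r, r < 1 & forall j (m n : nat),
    let eps := 2^-1 ^+ j in let s := eps `^ theta^-1 in
    m%:R <= s `^ (- d) -> n%:R <= (eps / 64) `^ (- (t / (1 - t))) ->
    (m * m)%:R * (12 * n%:R * ((6 * s) * j.+1%:R ^+ 2) / (eps / (12 * n%:R))) ^+ k
      <= C * r ^+ j].
Proof.
move=> t1 theta0 H.
have t1' : 0 < 1 - t by rewrite subr_gt0.
pose u := t / (1 - t).
pose kappa : R := - (2 * d) / theta + k%:R * (theta^-1 - 1 - 2 * u).
have kappa0 : 0 < kappa.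
  have -> : kappa = ((1 - t) * (k%:R - 2 * d) - theta * (k%:R * (1 + t))) / (theta * (1 - t)).
    by rewrite /kappa /u; field; rewrite !gt_eqF.
  by rewrite divr_gt0 ?subr_gt0// mulr_gt0.
pose a : R := 2^-1 `^ kappa.
have a0 : 0 < a by rewrite powR_gt0// invr_gt0.
have a1 : a < 1.
  have -> : 1 = 1 `^ kappa :> R by rewrite powR1.
  apply: gt0_ltr_powR => //; rewrite ?nnegrE ?invr_ge0//.
  by rewrite invf_lt1// ltr1n.
have [C [r [C0 r0 r1 HC]]] := poly_geometric_bound (2 * k) a0 a1.
(* [K] collects the 64 of the dimension bound; [A] adds the constants 12 and 6 of the probability
   bound. *)
pose K : R := (64^-1) `^ (- u).
pose A : R := (12 * 12 * 6) * K ^+ 2.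
have K0 : 0 < K by rewrite powR_gt0// invr_gt0.
have A0 : 0 < A by rewrite !mulr_gt0// exprn_gt0.
exists (A ^+ k * C), r; split=> // j m n eps s ms ns.
have e0 : 0 < eps := half_expn_gt0 j.
have s0 : 0 < s by rewrite powR_gt0.
have n0 : 0 <= n%:R :> R by [].
have ns' : n%:R <= K * eps `^ (- u).
  by move: ns; rewrite powRM ?invr_ge0 ?(ltW e0)// mulrC.
have -> : 12 * n%:R * (6 * s * j.+1%:R ^+ 2) / (eps / (12 * n%:R)) =
    (12 * 12 * 6) * n%:R ^+ 2 * j.+1%:R ^+ 2 * (s / eps).
  by rewrite invfM invrK; field; rewrite gt_eqF.
have j0 : 0 <= j.+1%:R ^+ 2 :> R by rewrite exprn_ge0.
have se0 : 0 <= s / eps by rewrite divr_ge0 ?ltW.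
set x1 := (12 * 12 * 6) * n%:R ^+ 2 * _ * _.
pose x2 := (12 * 12 * 6) * (K * eps `^ (- u)) ^+ 2 * j.+1%:R ^+ 2 * (s / eps).
have x10 : 0 <= x1 by apply: mulr_ge0 => //; apply: mulr_ge0 => //; rewrite mulr_ge0 ?exprn_ge0.
have x12 : x1 <= x2.
  apply: ler_wpM2r => //; apply: ler_wpM2r => //; rewrite ler_wpM2l ?mulr_ge0//.
  by rewrite lerXn2r ?nnegrE// mulr_ge0 ?powR_ge0 ?(ltW K0).
apply: (@le_trans _ _ ((s `^ (- d)) ^+ 2 * x2 ^+ k)).
  apply: ler_pM; rewrite ?exprn_ge0//; first by rewrite natrM expr2 ler_pM.
  by rewrite lerXn2r ?nnegrE// (le_trans x10).
rewrite /x2.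
have -> : (12 * 12 * 6) * (K * eps `^ (- u)) ^+ 2 * j.+1%:R ^+ 2 * (s / eps) =
    A * (j.+1%:R ^+ 2 * ((eps `^ (- u)) ^+ 2 * s / eps)).
  by rewrite /A; ring.
rewrite exprMn mulrCA -[leRHS]mulrA ler_wpM2l ?exprn_ge0 ?(ltW A0)//.
rewrite exprMn -exprM mulrCA.
have -> : (s `^ (- d)) ^+ 2 * ((eps `^ (- u)) ^+ 2 * s / eps) ^+ k = a ^+ j.
  have pE x y : (eps `^ x) `^ y = eps `^ (x * y) by rewrite powRrM.
  have XE x (l : nat) : (eps `^ x) ^+ l = eps `^ (x * l%:R) by rewrite -powR_mulrn ?powR_ge0// powRrM.
  have DE x y : eps `^ x * eps `^ y = eps `^ (x + y).
    by rewrite powRD//; apply/implyP => _; rewrite gt_eqF.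
  have VE : eps^-1 = eps `^ (- 1) by rewrite powR_inv1// ltW.
  rewrite VE /s pE !XE !DE XE DE.
  have -> : a ^+ j = eps `^ kappa.
    have h0 : 0 <= 2^-1 :> R by rewrite invr_ge0.
    rewrite /a /eps -(powR_mulrn j (powR_ge0 _ _)) -(powR_mulrn j h0) -!powRrM.
    by rewrite mulrC.
  by congr (_ `^ _); rewrite /kappa; field; rewrite gt_eqF.
exact: HC.
Qed.

End scales.

Section bad_events.
Context {R : realType} {B : normedModType R} (k : nat).
Local Notation RT n := (n.-tuple (measurableTypeR R)).
Variables (n : nat -> nat) (psi : forall j, 'I_(n j) -> B -> R^o) (e : forall j, 'I_(n j) -> B).
Hypothesis sys : forall j, dual_system (@psi j) (@e j).
Variables (d : nat -> nat) (b : forall j, 'I_(d j) -> B -> R^o).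
Hypothesis bV : forall j, is_basis (@b j) (range (lin_comb (@psi j))).
Local Notation index := ('I_k * nat)%type.
Local Notation T := (fun p : index => RT (d p.2)).
Local Notation Om := (familyType T).
Local Notation mu0 := (product_law (coordinate_law sys bV)).

Definition limit_map (i : 'I_k) (a : Om) (x : B) : R :=
  limn (series (fun j => j.+1%:R ^- 2 * functional_of b a i j x : R^o)).

Lemma functional_of_le (a : Om) : in_unit_balls b a -> forall i j x, `|functional_of b a i j x| <= `|x|.
Proof.
move=> aG i j x; have := aG (i, j); rewrite (unit_ball_coordE (sys j) (bV j)).
exact.
Qed.

Lemma linear_functional_of (a : Om) i j : linear (functional_of b a i j : B -> R^o).
Proof.
apply: linear_lin_comb => l.
have : range (lin_comb (@psi j)) (@b j l).
  rewrite (bV j).2; exists (fun m => (l == m)%:R) => //; exact: lin_comb_delta.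
by move=> [w _ <-]; apply: linear_lin_comb; have [] := sys j.
Qed.

Lemma limit_map_lin (a : Om) : in_unit_balls b a -> forall i c x y,
  limit_map i a (c *: x + y) = c * limit_map i a x + limit_map i a y.
Proof.
move=> aG i c x y; apply/cvg_lim => //.
have cx z := weighted_series_cvg (fun j => functional_of_le aG i j z).
rewrite (_ : series _ = (fun N => c * series (fun j => j.+1%:R ^- 2 * functional_of b a i j x : R^o) N +
    series (fun j => j.+1%:R ^- 2 * functional_of b a i j y : R^o) N)).
  by apply: cvgD; [apply: cvgMr; exact: cx|exact: cx].
apply/funext => N; rewrite /series/= mulr_sumr -big_split/=; apply: eq_bigr => j _.
by rewrite linear_functional_of mulrDr mulrCA.
Qed.

Lemma limit_mapB (a : Om) : in_unit_balls b a -> forall i x y,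
  limit_map i a (x - y) = limit_map i a x - limit_map i a y.
Proof.
by move=> aG i x y; rewrite addrC -scaleN1r limit_map_lin// mulN1r addrC.
Qed.

Lemma limit_map_le (a : Om) : in_unit_balls b a -> forall i x, `|limit_map i a x| <= 2 * `|x|.
Proof.
by move=> aG i x; apply: weighted_series_le => j; exact: functional_of_le.
Qed.

(** The event: some pair of net points at distance at least [eps / 2] has all its truncated rows
    bounded by [6 * s]. Points [x], [y] that violate the estimate lead to such a pair: its distance
    is at least $\epsilon - 2s \ge \epsilon/2$, and $6s$ is the sum of $s$ for the violation, $2s$
    for each replacement by a net point, and $s$ for the truncation. *)
Lemma bad_event (X : set B) (j m : nat) (c : 'I_m -> B) (D eps s : R) :
  0 < eps -> 0 < s -> s <= eps / 4 ->
  (forall x y, X x -> X y -> `|x - y| <= D) ->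
  (forall p, X (c p)) -> X `<=` \bigcup_p ball (c p) s ->
  (forall x y, X x -> X y -> eps / 2 <= `|x - y| ->
     exists2 l, (0 < n j)%N & eps / (12 * (n j)%:R) <= `|@psi j l (x - y)|) ->
  exists E : set Om, [/\ measurable E,
    (mu0 E <= ((m * m)%:R * (12 * (n j)%:R * ((6 * s) * j.+1%:R ^+ 2) /
       (eps / (12 * (n j)%:R))) ^+ k)%:E)%E &
    forall a : Om, in_unit_balls b a -> forall x y, X x -> X y -> eps <= `|x - y| ->
      (forall i, `|limit_map i a x - limit_map i a y| < s) -> E a].
Proof.
move=> eps0 s0 se XD Xc cX nrm.
(* Beyond [j], so that the functional of index [j] takes part in the sum, and far enough for the
   tail on differences of points of [X] to be at most [s]. *)
pose N := maxn j.+1 (Num.truncn (2 * D / s)).+1.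
have jN : (j < N)%N by rewrite leq_maxl.
have DN : 2 * D / N.+1%:R <= s.
  rewrite ler_pdivrMr ?ltr0n// (mulrC s) -ler_pdivrMr//.
  have [D0|D0] := leP 0 (2 * D / s); last by rewrite (le_trans (ltW D0)).
  have /andP[_ /ltW] := Num.Theory.truncn_itv D0.
  move=> /le_trans; apply; rewrite ler_nat; apply: leqW; exact: leq_maxr.
pose q := 12 * (n j)%:R * ((6 * s) * j.+1%:R ^+ 2) / (eps / (12 * (n j)%:R)).
pose F (p : 'I_m * 'I_m) : set Om := if eps / 2 <= `|c p.1 - c p.2|
  then [set a | forall i, slab_event b N i (c p.1 - c p.2) (6 * s) a] else set0.
have q0 : 0 <= q.
  by rewrite divr_ge0 ?divr_ge0 ?mulr_ge0 ?exprn_ge0 ?(ltW eps0) ?(ltW s0).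
have mF p : measurable (F p).
  rewrite /F; case: ifP => // _.
  rewrite (_ : [set a | _] = \bigcap_(i in [set: 'I_k]) slab_event b N i (c p.1 - c p.2) (6 * s)).
    by apply: fin_bigcap_measurable => [|i _]; [exact: finite_finset|exact: measurable_slab_event].
  by apply/seteqP; split=> a /= H i; [move=> _; exact: H|exact: (H i Logic.I)].
have Fq p : (mu0 (F p) <= (q ^+ k)%:E)%E.
  rewrite /F; case: ifP => [big|_]; last by rewrite measure0 lee_fin exprn_ge0.
  have [l n0 lz] := nrm _ _ (Xc p.1) (Xc p.2) big.
  apply: slab_events_le lz _ => //; last by rewrite mulr_gt0.
  by rewrite divr_gt0// mulr_gt0// ltr0n.
exists (\big[setU/set0]_(p <- index_enum ('I_m * 'I_m)%type) F p).
have [mE Eq] := measure_bigsetU_le (index_enum ('I_m * 'I_m)%type) mF Fq.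
split=> //.
  apply: le_trans Eq _; rewrite lee_fin -/q.
  by rewrite -[index_enum _]enumT -cardE card_prod !card_ord.
move=> a aG x y Xx Xy xy Lxy.
have [p _ xp] := cX x Xx; have [p' _ yp] := cX y Xy.
have {}xp : `|x - c p| < s by move: xp; rewrite -ball_normE/= distrC.
have {}yp : `|y - c p'| < s by move: yp; rewrite -ball_normE/= distrC.
rewrite -bigcup_seq; exists (p, p') => /=; first exact: mem_index_enum.
rewrite /F/=; case: ifPn => [_|/negP]; last first.
  case; have : `|x - y| <= `|c p - c p'| + `|x - c p| + `|y - c p'|.
    have -> : x - y = (c p - c p') + (x - c p) - (y - c p').
      by rewrite [c p - c p' + _]addrC addrA subrK opprB addrA subrK.
    by rewrite (le_trans (ler_normB _ _))// lerD2r ler_normD.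
  lra.
move=> i /=; rewrite /slab_event/=.
have := weighted_series_tail N (fun l => functional_of_le aG i l (c p - c p')).
rewrite -/(limit_map i a (c p - c p')) -/(partial_map b N i a (c p - c p')) => tl.
have tl' : `|limit_map i a (c p - c p') - partial_map b N i a (c p - c p')| <= s.
  apply: le_trans tl _; apply: le_trans DN; rewrite ler_wpM2r ?invr_ge0// ler_wpM2l//.
  exact: XD.
have h1 := limit_map_le aG i (x - c p); have h2 := limit_map_le aG i (y - c p').
move: tl' h1 h2 (Lxy i); rewrite !(limit_mapB aG).
set P := partial_map _ _ _ _ _.
move: xp yp; set A := `|x - c p|; set A' := `|y - c p'| => xp yp.
rewrite !ler_norml ltr_norml => /andP[u1 u2] /andP[v1 v2] /andP[w1 w2] /andP[z1 z2].
by apply/andP; split; lra.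
Qed.

End bad_events.

(** [fine] reads [-oo] as 0, a case where the conclusion is immediate; [+oo] is excluded by
    hypothesis. *)
Lemma fine_log_growth_lt (R : realType) (f : R -> \bar R) (c : R) :
  (log_growth f < +oo)%E -> fine (log_growth f) < c -> (log_growth f < c%:E)%E.
Proof. by case: log_growth => [r|//|] //= _ _; exact: ltNyr. Qed.

Lemma eucl_norm_ge (R : realType) (k : nat) (v : 'rV[R]_k) i : `|v 0 i| <= eucl_norm v.
Proof.
rewrite /eucl_norm -sqrtr_sqr ler_wsqrtr// (bigD1 i)//= lerDl.
by apply: sumr_ge0 => j _; exact: sqr_ge0.
Qed.

(** * Choice of the subspaces, Borel-Cantelli, and the conclusion for a good map *)

Theorem theorem1p6 (R : realType) (B : completeNormedModType R) (X : set B)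
    (k : nat) (theta : R) :
  compact X ->
  (thickness X < 1)%E ->
  (box_dim X < +oo)%E ->
  2 * fine (box_dim X) < k%:R ->
  0 < theta ->
  theta < (1 - fine (thickness X)) * ((k%:R - 2 * fine (box_dim X)) /
            (k%:R * (1 + fine (thickness X)))) ->
  exists V : nat -> set (B -> R^o),
    (forall n, dual_subspace (V n)) /\
    forall (d : nat -> nat) (b : forall n, 'I_(d n) -> B -> R^o),
      (forall n, is_basis (b n) (V n)) ->
      exists mu : probability (coordsType (R := R) k d) R,
        is_product_law b mu /\
        \forall a \ae mu,
          let L := map_of_coords b a in
          [/\ E2 V L,
              linear L,
              exists C : R, 0 < C /\ forall x y, X x -> X y ->
                `|x - y| <= C * eucl_norm (L x - L y) `^ theta,
              set_bij X (L @` X) L &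
              exists g : 'rV[R]_k -> B,
                (forall x, X x -> g (L x) = x) /\ hoelder_on theta (L @` X) g].
Proof.
move=> cX X1 Xoo Xk theta0 thetaX.
have tau0 : 0 <= fine (thickness X) by exact: fine_log_growth_ge0.
have dB0 : 0 <= fine (box_dim X) by exact: fine_log_growth_ge0.
have tau1 : fine (thickness X) < 1 by case: thickness X1 => [r||].
have [k0 [t [d' [taut t1 dd' tH]]]] := intermediate_exponents tau0 tau1 Xk theta0 thetaX.
have t0 : 0 <= t := ltW (le_lt_trans tau0 taut).
(* With [theta] below 1, [s j] becomes small compared with [eps j], so that net points of well
   separated points stay apart. *)
have theta1 : theta < 1.
  have kr : 1 <= k%:R :> R by rewrite ler1n.
  have d'0 : 0 <= d' := ltW (le_lt_trans dB0 dd').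
  have h1 : 0 < theta * k%:R by rewrite mulr_gt0// (lt_le_trans _ kr).
  have h2 : 0 <= theta * k%:R * t by rewrite mulr_ge0// ltW.
  have h3 : 0 <= t * k%:R by rewrite mulr_ge0.
  have h4 : 0 <= (1 - t) * d' by rewrite mulr_ge0// subr_ge0 ltW.
  rewrite ltNge; apply/negP => th1.
  have h5 : k%:R <= theta * k%:R by rewrite ler_peMl.
  by move: tH; lra.
have thick : (thickness X < t%:E)%E.
  by apply: fine_log_growth_lt => //; apply: lt_trans X1 _; exact: ltry.
have box : (box_dim X < d'%:E)%E by exact: fine_log_growth_lt.
have [e0 e00 nsys] := norming_system t0 t1 thick.
pose pairs (n : nat) := (('I_n -> B -> R^o) * ('I_n -> B))%type.
pose data := {n : nat & pairs n}.
have /choice[f fP] : forall j, exists fj : data,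
    dual_system (projT2 fj).1 (projT2 fj).2 /\
    (2^-1 ^+ j < e0 ->
      (projT1 fj)%:R <= ((2^-1 : R) ^+ j / 64) `^ (- (t / (1 - t))) /\
      forall x y, X x -> X y -> 2^-1 ^+ j / 2 <= `|x - y| ->
        exists2 l, (0 < projT1 fj)%N &
          2^-1 ^+ j / (12 * (projT1 fj)%:R) <= `|(projT2 fj).1 l (x - y)|).
  move=> j; have [je0|je0] := ltP ((2^-1 : R) ^+ j) e0.
    have [n [psi [e [sys nn nrm]]]] := nsys _ (half_expn_gt0 j) je0.
    by exists (existT pairs n (psi, e)); split.
  (* At the finitely many coarse scales the zero subspace is taken. *)
  exists (existT pairs 0%N ((fun _ _ => 0), (fun _ => 0))); split => //.
  by split=> [[]|[]|[]].
pose n j := projT1 (f j).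
pose psi j : 'I_(n j) -> B -> R^o := (projT2 (f j)).1.
have sys j : dual_system (psi j) (projT2 (f j)).2 := (fP j).1.
(* The subspaces are fixed before the bases: the law is then described in whatever coordinates are
   given. *)
exists (fun j => range (lin_comb (psi j))); split.
  by move=> j; exact: dual_subspace_range (sys j).
move=> d b bV.
pose mu0 := product_law (coordinate_law (k := k) sys bV).
exists (coords_law (coordinate_law (k := k) sys bV)); split.
  move=> N A mA; apply: etrans (coords_law_cylinder _ _ mA) _.
  apply: eq_bigr => i _; apply: eq_bigr => m _.
  exact: uniform_probabilityE.
have [D XD] : exists D : R, forall x y, X x -> X y -> `|x - y| <= D.
  have [M [_ MX]] := compact_bounded cX.
  have {}MX x : X x -> `|x| <= M + 1 by apply: MX; rewrite ltrDl.
  exists ((M + 1) + (M + 1)) => x y Xx Xy.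
  by rewrite (le_trans (ler_normB _ _))// lerD// MX.
have [C [r [r0 r1 est]]] := scale_estimate t1 theta0 tH.
pose eps j : R := 2^-1 ^+ j.
pose s j : R := eps j `^ theta^-1.
have [J1 J1P] : exists J, forall j, (J <= j)%N -> eps j < e0.
  have [J JP] := near_half_powR ltr01 (nbhs_right_lt e00).
  by exists J => j /JP; rewrite invr1 powRr1// ltW// half_expn_gt0.
have [J2 J2P] := near_half_powR theta0 (covering_growth box).
have [J3 J3P] : exists J, forall j, (J <= j)%N -> s j <= eps j / 4.
  (* $s_j \le \epsilon_j/4$ means $\epsilon_j^{1/\theta - 1} \le 1/4$, hence this parameter for
     [near_half_powR]. *)
  have th : 0 < (theta^-1 - 1)^-1 by rewrite invr_gt0 subr_gt0 invf_gt1.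
  have q4 : 0 < 4^-1 :> R by rewrite invr_gt0.
  have [J JP] := near_half_powR th (nbhs_right_lt q4).
  exists J => j /JP; rewrite invrK /s => H.
  have -> : theta^-1 = (theta^-1 - 1) + 1 by rewrite subrK.
  rewrite powRD; last by apply/implyP => _; rewrite gt_eqF// half_expn_gt0.
  by rewrite powRr1 ?(ltW (half_expn_gt0 j))// mulrC ler_wpM2l ?(ltW (half_expn_gt0 j))// ltW.
pose J := maxn J1 (maxn J2 J3).
have /choice[E EP] : forall j,
    exists E : set (familyType (fun p : ('I_k * nat)%type => (d p.2).-tuple (measurableTypeR R))),
    [/\ measurable E, (mu0 E <= (`|C| * r ^+ j)%:E)%E &
    (J <= j)%N -> forall a, in_unit_balls b a -> forall x y, X x -> X y -> eps j <= `|x - y| ->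
      (forall i, `|limit_map b i a x - limit_map b i a y| < s j) -> E a].
  move=> j; have [Jj|jJ] := leqP J j; last first.
    (* Scales before [J] carry no requirement; the empty event satisfies the bound there. *)
    exists set0; split => //.
    by rewrite /mu0 product_law0 lee_fin mulr_ge0// exprn_ge0// ltW.
  move: Jj; rewrite !geq_max => /and3P[j1 j2 j3].
  have [m [c [mc Xc cvX]]] := J2P _ j2.
  have [nn nrm] := (fP j).2 (J1P _ j1).
  have s0 : 0 < s j by rewrite powR_gt0// half_expn_gt0.
  have [E [mE Em EX]] := @bad_event _ _ k _ _ _ sys _ _ bV X j m c D (eps j) (s j)
    (half_expn_gt0 j) s0 (J3P _ j3) XD Xc cvX nrm.
  exists E; split => //; apply: le_trans Em _; rewrite lee_fin.
  apply: le_trans (est j m (n j) (ltW mc) nn) _.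
  by rewrite ler_wpM2r ?ler_norm// exprn_ge0// ltW.
have negE : mu0.-negligible (lim_sup_set E).
  apply/negligibleP.
    apply: bigcap_measurable => // l _.
    by apply: bigcup_measurable => j _; have [] := EP j.
  apply: lim_sup_set_cvg0; first by move=> j; have [] := EP j.
  by apply: (nneseries_geometric_lty (C := `|C|) r0 r1) => j; [exact: measure_ge0|have [] := EP j].
(* The exceptional set: some functional lies outside its unit ball, or infinitely many bad events
   occur. Every other family [c] is now treated individually. *)
have := coords_law_negligible (negligibleU (in_unit_balls_negligible k sys bV) negE).
apply: negligibleS => c nQ; apply: contrapT => /not_orP[/contrapT cG ncE]; apply: nQ.
set a := uncurry_family c in cG ncE.
have linL : linear (map_of_coords b c).
  move=> l x y; apply/rowP => i; rewrite !mxE.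
  exact: (limit_map_lin sys bV cG).
have [l0 Pl0] : exists l0, forall j, (l0 <= j)%N -> ~ E j a.
  move/existsNP : ncE => [l0] /not_implyP[_ H]; exists l0 => j lj Ej.
  by apply: H; exists j.
have [C0 [C00 HC0]] : exists C : R, 0 < C /\ forall x y, X x -> X y ->
    `|x - y| <= C * eucl_norm (map_of_coords b c x - map_of_coords b c y) `^ theta.
  apply: (@hoelder_from_scales _ _ X theta D (maxn l0 J)
    (fun x y => eucl_norm (map_of_coords b c x - map_of_coords b c y))) => //.
    by move=> x y; exact: sqrtr_ge0.
  move=> j x y; rewrite geq_max => /andP[lj Jj] Xx Xy xy.
  (* A Euclidean norm below [s j] makes every row smaller than [s j], which would put [a] in [E j],
     excluded for [j] beyond [l0]. *)
  rewrite leNgt; apply/negP => small; apply: (Pl0 j lj).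
  have [_ _ H] := EP j; apply: (H Jj a cG x y Xx Xy xy) => i.
  apply: le_lt_trans small.
  have := eucl_norm_ge (map_of_coords b c x - map_of_coords b c y) i.
  by rewrite !mxE.
have injL x y : X x -> X y -> map_of_coords b c x = map_of_coords b c y -> x = y.
  move=> Xx Xy Lxy; apply/eqP; rewrite -subr_eq0 -normr_le0.
  have := HC0 x y Xx Xy; rewrite Lxy subrr {1}/eucl_norm big1 ?sqrtr0; last first.
    by move=> i _; rewrite mxE expr0n.
  by rewrite powR0 ?gt_eqF// mulr0.
split => //.
- exists (fun i j => lin_comb (b j) (tnth (c i j))) => // i j; split.
    by rewrite (bV j).2; exists (tnth (c i j)).
  exact: (cG (i, j)).
- by exists C0.
- split=> [x Xx|x y /set_mem Xx /set_mem Xy|_ [x Xx <-]].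
  + by exists x.
  + exact: injL.
  + by exists x.
pose g v := xget 0 [set x | X x /\ map_of_coords b c x = v].
have gL x : X x -> g (map_of_coords b c x) = x.
  move=> Xx; rewrite /g; case: xgetP => [y _ [Xy /injL]|/(_ x)]; first by apply.
  by move=> /not_andP[].
exists g; split => //; exists C0; split => // _ _ [x Xx <-] [y Xy <-].
by rewrite !gL//; exact: HC0.
Qed.
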